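(* Let $d>1$. For every real $M\ge 0$ there exists a totally strictly ergodic $\mathbb{Z}^d$-action $(X,\mathcal{B},\mu,T)$, where $X$ is a compact metric space on which $\mathbb{Z}^d$ acts by homeomorphisms, whose topological entropy is positive and satisfies $h(X,T)\ge M$.
   Context: For a $\mathbb{Z}^d$-action $T$ on a compact metric space $X$ with Borel $\sigma$-algebra $\mathcal{B}$, write $T^g:X\to X$ for the map associated with $g\in\mathbb{Z}^d$, so $T^{g+h}=T^gT^h$ and $T^0=\mathrm{id}$. For a subgroup $F\le\mathbb{Z}^d$, $T|_F$ denotes the restricted $F$-action. An action of $F$ is minimal if every orbit is dense in $X$, uniquely ergodic if it has exactly one invariant Borel probability measure, and strictly ergodic if it is both minimal and uniquely ergodic. The $\mathbb{Z}^d$-action is totally strictly ergodic if, for every subgroup $F\le\mathbb{Z}^d$ of finite index, the $F$-action $(X,T|_F)$ is strictly ergodic. In $(X,\mathcal{B},\mu,T)$, $\mu$ is the (unique) $T$-invariant Borel probability measure. $h(X,T)$ is the topological entropy of the $\mathbb{Z}^d$-action; for a subshift (a closed shift-invariant $X\subset\mathcal{C}^{\mathbb{Z}^d}$, $\mathcal{C}$ a finite alphabet, with the shift action $(T^gx)(h)=x(g+h)$) it is $h(X,T)=\lim_{n\to\infty} n^{-d}\log\left|\{x|_{[0,n)^d} : x\in X\}\right|$, where $[0,n)=\{0,1,\dots,n-1\}$. *)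

(* Defs.v *)
From HB Require Import structures.
From mathcomp Require Import all_boot all_order all_algebra.
From mathcomp Require Import all_classical all_reals all_analysis.
Import Order.TTheory GRing.Theory Num.Theory.
Import numFieldNormedType.Exports.

Set Implicit Arguments.
Unset Strict Implicit.
Unset Printing Implicit Defensive.

Local Open Scope classical_set_scope.
Local Open Scope ring_scope.

(* Measurable types are pointed, so the Borel sigma-algebra below needs a
   distinguished point. This only excludes the empty space, which carries no
   probability measure. *)
#[short(type="pmetricType")]
HB.structure Definition PointedMetric (K : numDomainType) :=
  { M of Metric K M & isPointed M }.

Definition borel (X : ptopologicalType) := g_sigma_algebraType (@open X).

(* Each T g is a homeomorphism: its inverse T (- g) is continuous as well. *)
Definition continuous_action (d : nat) (X : topologicalType)
    (T : 'rV[int]_d -> X -> X) : Prop :=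
  [/\ T 0 = id,
      forall g h, T (g + h) = T g \o T h
    & forall g, continuous (T g)].

Definition is_subgroup (G : zmodType) (F : set G) : Prop :=
  F 0 /\ forall g h, F g -> F h -> F (g - h).

Definition finite_index (G : zmodType) (F : set G) : Prop :=
  finite_set (range (fun g : G => [set h | F (h - g)])).

Section ergodicity.
Variables (R : realType) (d : nat) (X : pmetricType R).
Variables (T : 'rV[int]_d -> X -> X) (F : set 'rV[int]_d).

Definition minimal_action : Prop := forall x, dense [set T g x | g in F].

Definition invariant_measure (mu : probability (borel X) R) : Prop :=
  forall g, F g -> forall A : set (borel X), measurable A ->
    mu (T g @^-1` A) = mu A.

(* Measures are functions on all subsets of X; only their values on Borel sets
   are meaningful, hence the form of uniqueness. *)
Definition uniquely_ergodic : Prop :=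
  exists2 mu : probability (borel X) R, invariant_measure mu &
    forall nu : probability (borel X) R, invariant_measure nu ->
      forall A : set (borel X), measurable A -> nu A = mu A.

Definition strictly_ergodic : Prop := minimal_action /\ uniquely_ergodic.

End ergodicity.

Definition totally_strictly_ergodic (R : realType) (d : nat)
    (X : pmetricType R) (T : 'rV[int]_d -> X -> X) : Prop :=
  forall F : set 'rV[int]_d, is_subgroup F -> finite_index F ->
    strictly_ergodic T F.

Section topological_entropy.
Variables (R : realType) (d : nat) (X : topologicalType).
Variable T : 'rV[int]_d -> X -> X.

Definition box (n : nat) : set 'rV[int]_d :=
  [set g | forall i, 0 <= g ord0 i < n%:Z].

Definition open_cover (U : set (set X)) : Prop :=
  (forall A, U A -> open A) /\ cover U id = [set: X].

(* The common refinement of the covers T^{-g} U for g in [0, n)^d. *)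
Definition iterated_join (U : set (set X)) (n : nat) : set (set X) :=
  [set \bigcap_(g in box n) (T g @^-1` A g) |
     A in [set A : 'rV[int]_d -> set X | forall g, box n g -> U (A g)]].

(* The least cardinality of a finite subcover. *)
Definition cover_number (U : set (set X)) : R :=
  inf [set k%:R | k in [set k : nat | exists V : set (set X),
    [/\ V `<=` U, (V #= `I_k)%card & cover V id = [set: X]]]].

Definition cover_entropy (U : set (set X)) : R :=
  limn (fun n : nat => ln (cover_number (iterated_join U n)) / n%:R ^+ d : R).

(* Adler-Konheim-McAndrew definition. *)
Definition topological_entropy : \bar R :=
  ereal_sup [set (cover_entropy U)%:E | U in open_cover].

End topological_entropy.

Arguments topological_entropy R {d X} T.

(* Main.v *)
(* Block construction.  A level-(k+1) block is a cubic array of level-k blocks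
   such that, on each line in the first direction and inside each residue class
   modulo (k+1)!, every level-k block occurs exactly once.  All these arrays are
   used, so that the numbers N_k of blocks and n_k of copies per side satisfy
   ln N_(k+1) >= n_k^d (ln N_k - 1) and little entropy is lost.

   Neighbouring copies of level-k blocks are adjacent if k is even and separated
   by a spacer of width 1 if k is odd.  This makes the distance between
   neighbouring copies congruent to 1 or -1 modulo k!, so the positions of the
   copies equidistribute modulo each fixed q: no rational eigenvalue survives,
   and for k >= q all level-(k+1) blocks have the same frequency of a given
   level-k block in every residue class modulo q.

   The subshift of all configurations whose windows occur in blocks therefore has
   frequencies converging uniformly along q Z^d, which gives uniqueness of the
   q Z^d-invariant measure; minimality comes from the same count.  Every subgroup
   of finite index contains some q Z^d.  The invariant measure is the
   Caratheodory extension of an ultrafilter limit of visit frequencies. *)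

Require Import Defs.
From HB Require Import structures.
From mathcomp Require Import all_boot all_order all_algebra perm.
From mathcomp Require Import all_classical all_reals all_analysis.
From mathcomp Require Import measurable_realfun.
From mathcomp Require Import zify ring lra.

Set Implicit Arguments.
Unset Strict Implicit.
Unset Printing Implicit Defensive.
Import Order.TTheory GRing.Theory Num.Theory.
Import numFieldNormedType.Exports.

(** * Blocks *)

Section Blocks.
Variables (D : nat) (A : finType) (a0 : A).

Local Notation vec := ('I_D.+1 -> nat).

(* [content c] is a total function; it is the block [c] on the cube
   [[0, side)^d], where [side] is [stride] minus the spacer width. *)
Record blocks := Blocks {
  stride : nat;
  label : finType;
  base_label : label;
  content : label -> vec -> A }.

Section NextBlocks.
(* [e] and [e'] are the spacer widths of the old and of the new level, and the
   modulus is [s.+1]. *)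
Variables (s : nat) (e e' : bool) (B : blocks).

Definition subdiv := (s.+1 * #|label B|)%N.

Lemma subdiv_gt0 : 0 < subdiv.
Proof. by rewrite muln_gt0 /=; apply/card_gt0P; exists (base_label B). Qed.

Definition arrangement : finType :=
  {ffun ('I_s.+1 * {ffun 'I_D -> 'I_subdiv}) -> {perm label B}}.

(* A line is given by the residue of its first coordinate and by the remaining
   coordinates; [f] assigns to it the order in which the labels occur on it. *)
Definition label_at (f : arrangement) (j : vec) : label B :=
  f (Ordinal (ltn_pmod (j ord0) (ltn0Sn s)),
     [ffun i => Ordinal (ltn_pmod (j (lift ord0 i)) subdiv_gt0)])
    (nth (base_label B) (enum (label B)) ((j ord0 %% subdiv) %/ s.+1)).

(** A stride includes the trailing spacer of its block: the last copy loses the old spacer [e], and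
    the new spacer [e'] follows. A spacer site gets the value of the lower [content] just outside
    its cube. *)
Definition next_blocks := Blocks
  (subdiv * stride B + e' - e) ([ffun=> 1%g] : arrangement)
  (fun f v => @content B (label_at f (fun i => v i %/ stride B))
                         (fun i => v i %% stride B)).

End NextBlocks.

Fixpoint level k : blocks :=
  if k is k'.+1 then next_blocks (k'.+1)`!.-1 (odd k') (odd k) (level k')
  else Blocks 1 a0 (fun a _ => a).

Definition step k := stride (level k).
Definition lab k := label (level k).
Definition nsub k := subdiv (k.+1)`!.-1 (level k).
Definition side k := step k - odd k.
Definition cont k : lab k -> vec -> A := @content (level k).

Lemma nsub_eq k : nsub k = (k.+1)`! * #|lab k|.
Proof. by rewrite /nsub /subdiv prednK ?fact_gt0. Qed.

Lemma nsub_gt0 k : 0 < nsub k.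
Proof. exact: subdiv_gt0. Qed.

Lemma stepS k : step k.+1 = nsub k * step k + odd k.+1 - odd k.
Proof. by []. Qed.

Definition lab_at k (f : lab k.+1) (j : vec) : lab k := @label_at _ (level k) f j.

Lemma contS k (f : lab k.+1) v :
  cont f v = cont (lab_at f (fun i => v i %/ step k)) (fun i => v i %% step k).
Proof. by []. Qed.

Hypothesis A_large : 3 < #|A|.

Lemma card_perm_type (T : finType) : #|{perm T}| = (#|T|)`!.
Proof.
rewrite -[in RHS](cardsT T) -card_perm; apply: eq_card => p; rewrite [RHS]unfold_in.
by apply/esym/fintype.subsetP => x; rewrite inE.
Qed.

Lemma card_labS k :
  #|lab k.+1| = ((#|lab k|)`! ^ ((k.+1)`! * nsub k ^ D))%N.
Proof.
by rewrite /lab /= card_ffun card_prod card_ffun !card_ord card_perm_type prednK ?fact_gt0.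
Qed.

Lemma leq_fact n : n <= n`!.
Proof. by case: n => // n; rewrite factS leq_pmulr ?fact_gt0. Qed.

Lemma card_lab k : #|A| <= #|lab k|.
Proof.
elim: k => [//|k IH]; rewrite card_labS.
apply: (leq_trans IH); apply: (leq_trans (leq_fact _)).
rewrite -{1}(expn1 (_`!)) leq_pexp2l ?fact_gt0 //.
by rewrite muln_gt0 fact_gt0 expn_gt0 nsub_gt0.
Qed.

Lemma nsub_ge k : 3 < nsub k.
Proof.
rewrite nsub_eq; apply: (leq_trans A_large); apply: (leq_trans (card_lab k)).
by rewrite leq_pmull ?fact_gt0.
Qed.

(** This growth makes the cores wide in [uniform_visits] and controls the entropy lost at each level
    in [ln_lab_ge]. *)
Lemma step_ge k : 2 ^ k <= step k.
Proof.
elim: k => [//|k IH]; rewrite stepS expnS.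
have := nsub_ge k; have : 0 < 2 ^ k by rewrite expn_gt0.
by case: (odd k) => /=; nia.
Qed.

Lemma step_gt0 k : 0 < step k.
Proof. by apply: leq_trans (step_ge k); rewrite expn_gt0. Qed.

Lemma sideE k : step k = side k + odd k.
Proof. by rewrite /side subnK //; case: odd => //; apply: step_gt0. Qed.

Lemma sideS k : side k.+1 = nsub k * step k - odd k.
Proof.
rewrite /side stepS; have := nsub_gt0 k; have := step_gt0 k.
by case: (odd k) => /=; nia.
Qed.

Lemma side_mono k : side k < side k.+1.
Proof.
rewrite sideS /side; have := nsub_ge k; have := step_gt0 k.
by case: (odd k) => /=; nia.
Qed.

Lemma side_gt0 k : 0 < side k.
Proof. by case: k => [//|k]; apply: leq_ltn_trans (side_mono k). Qed.

Lemma leq_side k k' : k <= k' -> side k <= side k'.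
Proof.
apply: (@homo_leq _ side leq leqnn) => // *; first by apply: leq_trans; eassumption.
exact: ltnW (side_mono _).
Qed.

(* [step k] is [odd k - odd k.-1 = +1 or -1] modulo [k!]. *)
Lemma coprime_step k q : 0 < q <= k -> coprime q (step k).
Proof.
case: k => [|k] /andP[q0 qk]; first by lia.
have /dvdnP[c qn] : q %| nsub k by rewrite nsub_eq dvdn_mulr ?dvdn_fact ?q0.
rewrite stepS qn /coprime -dvdn1.
have := dvdn_gcdl q (c * q * step k + odd k.+1 - odd k).
have := dvdn_gcdr q (c * q * step k + odd k.+1 - odd k).
set g := gcdn _ _ => /dvdnP[a Ha] /dvdnP[b Hb].
have gq : g %| c * q * step k by rewrite Hb mulnA dvdn_mulr // dvdn_mull.
have : g %| c * q * step k + odd k.+1 - odd k by rewrite Ha dvdn_mull.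
have := step_gt0 k; have := nsub_gt0 k; rewrite qn => c0 s0.
rewrite /=; case: (odd k) => /= H.
  rewrite addn0 in H; have : g %| c * q * step k - (c * q * step k - 1).
    by rewrite dvdn_sub.
  by rewrite subKn // muln_gt0 c0.
by rewrite subn0 dvdn_addr in H.
Qed.

(* [p] is a coordinate at which a copy of a level-[k] block starts inside each
   level-[K] block; by the product structure this is independent of the block
   and of the direction. *)
Fixpoint start k K p :=
  if K == k then p == 0
  else if K is K'.+1 then (p %/ step K' < nsub K') && start k K' (p %% step K')
  else false.

Lemma start_refl k p : start k k p = (p == 0).
Proof. by case: k => //= k; rewrite eqxx. Qed.

Lemma startS k K p : k <= K ->
  start k K.+1 p = (p %/ step K < nsub K) && start k K (p %% step K).
Proof. by move=> kK /=; case: eqP => // H; lia. Qed.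

Lemma start_bound k K p : k <= K -> start k K p -> p + side k <= side K.
Proof.
move=> /subnK <-; elim: (K - k) p => [|n IH] p; first by rewrite start_refl => /eqP ->.
rewrite addSn startS ?leq_addl // => /andP[H1 /IH H2]; rewrite sideS.
have := divn_eq p (step (n + k)); have := sideE (n + k).
move: H1 H2; set j := p %/ _; set r := p %% _; nia.
Qed.

Lemma start_sep k K p p' : k <= K -> start k K p -> start k K p' -> p < p' ->
  p + side k <= p'.
Proof.
move=> /subnK <-; elim: (K - k) p p' => [|n IH] p p'.
  by rewrite !start_refl => /eqP -> /eqP ->.
rewrite addSn !startS ?leq_addl // => /andP[H1 H2] /andP[H1' H2'].
have := start_bound (leq_addl n k) H2.
have := divn_eq p (step (n + k)); have := sideE (n + k).
have := divn_eq p' (step (n + k)).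
move: H1 H2 H1' H2'; set j := p %/ _; set r := p %% _; set j' := p' %/ _; set r' := p' %% _.
move=> H1 H2 H1' H2' E' S E B lt.
have [jj|jj|jj] := ltngtP j j'; [nia|nia|].
have := IH _ _ H2 H2'; nia.
Qed.

Lemma start_last k K : k <= K -> start k K (side K - side k).
Proof.
move=> /subnK <-; elim: (K - k) => [|n IH]; first by rewrite start_refl subnn.
rewrite addSn startS ?leq_addl // sideS.
have le := leq_side (leq_addl n k); have := sideE (n + k); have nn := nsub_gt0 (n + k).
have m0 := side_gt0 k; move=> S.
have -> : nsub (n + k) * step (n + k) - odd (n + k) - side k =
  (nsub (n + k)).-1 * step (n + k) + (side (n + k) - side k) by nia.
rewrite divnMDl ?step_gt0 // modnMDl divn_small ?modn_small; [|lia..].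
by rewrite addn0 IH; lia.
Qed.

(** A block of any level ends with a block of each lower level ([start_last]), so spacers of
    different levels never add up and a gap between copies has width at most 1. Hence the second
    bound is not strict. *)
Lemma start_gap k K u : k <= K -> u < side K ->
  exists2 p, start k K p & p <= u <= p + side k.
Proof.
move=> /subnK <-; elim: (K - k) u => [|n IH] u uK.
  by exists 0; [rewrite start_refl|rewrite add0n leq0n ltnW].
have kK := leq_addl n k.
move: uK; rewrite addSn sideS => uK.
have E := divn_eq u (step (n + k)); have S := sideE (n + k).
have s0 := step_gt0 (n + k).
have R : u %% step (n + k) < step (n + k) by rewrite ltn_mod.
move: E R; set j := u %/ _; set r := u %% _ => E R.
have jn : j < nsub (n + k) by nia.
have le := leq_side kK.
have [p pS pr] : exists2 p, start k (n + k) p & p <= r <= p + side k.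
  have [/IH//|rK] := ltnP r (side (n + k)).
  (* Here [r] is the spacer site itself. *)
  exists (side (n + k) - side k); first exact: start_last.
  by have := side_gt0 k; case: (odd (n + k)) S => /=; lia.
have b := start_bound kK pS.
exists (j * step (n + k) + p); last by lia.
have ps : p < step (n + k) by have := side_gt0 k; lia.
by rewrite startS // divnMDl // modnMDl divn_small ?modn_small // addn0 jn.
Qed.

(** At no intermediate level does adding [v] leave the sub-block containing [p], so the labels met
    on the way down depend on [p] alone. *)
Lemma start_content k K (c : lab K) (p : vec) : k <= K ->
  (forall i, start k K (p i)) ->
  exists c' : lab k, forall v : vec, (forall i, v i < side k) ->
    cont c (fun i => p i + v i) = cont c' v.
Proof.
move=> kK; rewrite -(subnK kK) in c *; elim: (K - k) c p => [|n IH] c p Hp.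
  exists c => v _; congr (cont c _); apply/boolp.funext => i.
  by have := Hp i; rewrite start_refl => /eqP ->.
have kn := leq_addl n k.
have Hp' i : (p i %/ step (n + k) < nsub (n + k)) && start k (n + k) (p i %% step (n + k)).
  by have := Hp i; rewrite addSn startS ?leq_addl.
have [|c' Hc'] := IH (lab_at c (fun i => p i %/ step (n + k))) (fun i => p i %% step (n + k)).
  by move=> i; case/andP: (Hp' i).
exists c' => v Hv; rewrite contS -Hc' //.
have H i : p i %% step (n + k) + v i < step (n + k).
  case/andP: (Hp' i) => _ /(start_bound kn).
  by have := sideE (n + k); have := Hv i; lia.
congr (cont (lab_at c _) _); apply/boolp.funext => i.
  rewrite {1}(divn_eq (p i) (step (n + k))) -addnA divnMDl ?step_gt0 //.
  by rewrite (divn_small (H i)) addn0.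
change ((p i + v i) %% step (n + k) = p i %% step (n + k) + v i).
by rewrite {1}(divn_eq (p i) (step (n + k))) -addnA modnMDl (modn_small (H i)).
Qed.

End Blocks.

(** * Counting occurrences of patterns *)

Lemma big_ord_mul (a b : nat) (F : nat -> nat) :
  \sum_(j < a * b) F j = \sum_(i < a) \sum_(r < b) F (i * b + r).
Proof.
rewrite -(big_mkord xpredT) big_nat_mul big_mkord; apply: eq_bigr => i _.
rewrite -{1}[(i * b)%N]add0n big_addn mulSn addnK big_mkord.
by apply: eq_bigr => r _; rewrite addnC.
Qed.

(** As [t] is invertible modulo [q], the map [r -> a + r * t] permutes the residues over each run of
    [q] consecutive [r]. *)
Lemma sum_dvdn_lin q n a t : 0 < q -> q %| n -> coprime q t ->
  \sum_(r < n) (q %| a + r * t) = n %/ q.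
Proof.
move=> q0 /dvdnP[c ->] qt; rewrite (big_ord_mul c q (fun r => q %| a + r * t : nat)) mulnK //.
rewrite -[RHS]muln1 -[c in RHS]card_ord -sum_nat_const; apply: eq_bigr => i _.
pose h (r : 'I_q) : 'I_q := Ordinal (ltn_pmod (a + r * t) q0).
have hinj : injective h.
  move=> r r' /(congr1 val) /= /eqP; rewrite eqn_modDl => H; apply/val_inj => /=.
  wlog : r r' H / r' <= r.
    by move=> W; case/orP: (leq_total r' r) => ?; [|symmetry]; apply: W => //; rewrite eq_sym.
  move=> le; have : q %| (r - r') * t by rewrite mulnBl -eqn_mod_dvd // leq_mul2r le orbT.
  rewrite Gauss_dvdl //; have := ltn_ord r; move=> rq /dvdn_leq; lia.
transitivity (\sum_(r < q) (val (h r) == 0)).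
  apply: eq_bigr => r _; rewrite /= /dvdn.
  have -> : a + (i * q + r) * t = (i * t) * q + (a + r * t) by lia.
  by rewrite modnMDl.
rewrite -(reindex_inj hinj (P := xpredT) (F := fun y : 'I_q => nat_of_bool (val y == 0))).
rewrite (bigD1 (Ordinal q0)) //= big1 // => y /eqP yn; case: eqP => // y0.
by case: yn; apply/val_inj.
Qed.

Lemma prod_nat_forall (I : finType) (P : pred I) : \prod_i (P i : nat) = [forall i, P i].
Proof.
case: forallP => [H|H]; first by rewrite big1 // => i _; rewrite H.
have /existsP[i Pi] : [exists i, ~~ P i].
  by rewrite -negb_forall; apply/forallP.
by rewrite (bigD1 i) //= (negbTE Pi).
Qed.

Lemma sum_ffun_forall (I J : finType) (P : I -> pred J) :
  \sum_(f : {ffun I -> J}) [forall i, P i (f i)] = \prod_i \sum_j P i j.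
Proof.
by rewrite bigA_distr_bigA; apply: eq_bigr => f _; rewrite -prod_nat_forall.
Qed.

Lemma sum_pred_card (T : finType) (P : pred T) : \sum_x (P x : nat) = #|P|.
Proof.
by rewrite -sum1_card [RHS]big_mkcond /=; apply: eq_bigr => x _; rewrite unfold_in; case: (P x).
Qed.

(** * Splitting off the first coordinate *)

Section Cons.
Variables (D : nat) (T : Type).

Definition vcons (x : T) (J : 'I_D -> T) (i : 'I_D.+1) : T :=
  if unlift ord0 i is Some k then J k else x.

Lemma vcons0 x J : vcons x J ord0 = x.
Proof. by rewrite /vcons unlift_none. Qed.

Lemma vconsS x J i : vcons x J (lift ord0 i) = J i.
Proof. by rewrite /vcons liftK. Qed.

End Cons.

Lemma forall_ord_recl D (P : pred 'I_D.+1) :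
  [forall i, P i] = P ord0 && [forall i, P (lift ord0 i)].
Proof.
apply/forallP/andP => [H|[H0 /forallP H] i]; first by split => //; apply/forallP.
by case: (unliftP ord0 i) => [j|] ->.
Qed.

Lemma sum_ffun_recl D (T : finType) (F : {ffun 'I_D.+1 -> T} -> nat) :
  \sum_f F f = \sum_x \sum_(J : {ffun 'I_D -> T}) F [ffun i => vcons x J i].
Proof.
rewrite pair_bigA /=.
apply: (reindex (fun p : T * {ffun 'I_D -> T} => [ffun i => vcons p.1 p.2 i])).
exists (fun f : {ffun 'I_D.+1 -> T} => (f ord0, [ffun i => f (lift ord0 i)])) => [[x J] _|f _] /=.
  rewrite ffunE vcons0; congr pair; apply/ffunP => i; by rewrite !ffunE vconsS.
apply/ffunP => i; rewrite ffunE.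
by case: (unliftP ord0 i) => [j|] ->; rewrite ?vcons0 ?vconsS ?ffunE.
Qed.

Section Counting.
Variables (D : nat) (A : finType) (a0 : A).
Hypothesis A_large : 3 < #|A|.
Local Notation vec := ('I_D.+1 -> nat).
Local Notation lab := (lab D a0).
Local Notation step := (step D a0).
Local Notation nsub := (nsub D a0).
Local Notation side := (side D a0).

Lemma sum_perm_nth (T : finType) (t0 : T) (p : {perm T}) (c : T) :
  \sum_(i < #|T|) (p (nth t0 (enum T) i) == c) = 1.
Proof.
transitivity (\sum_(x : T) (p x == c)).
  rewrite [RHS](reindex (@enum_val T T)) /=; last exact/onW_bij/enum_val_bij.
  by apply: eq_bigr => i _; rewrite (enum_val_nth t0).
rewrite (bigD1 (p^-1%g c)) //= permKV eqxx big1 ?addn0 // => x /eqP xc.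
by case: eqP => // E; case: xc; rewrite -E permK.
Qed.

(** The first factor comes from the first direction, where a label occurs once in each class modulo
    (k+1)!; each of the other [D] directions contributes a factor [nsub k %/ q]. *)
Definition density k q := ((k.+1)`! %/ q) * (nsub k %/ q) ^ D.

(** Write the first index as i (k+1)! + r. Since [q] divides (k+1)!, divisibility depends on [r]
    only, and for fixed [r] exactly one [i] carries the label [c]. Counting [r] and the other
    coordinates is [sum_dvdn_lin], as [step k] is coprime to [q]. *)
Lemma count_label k (f : lab k.+1) (c : lab k) q (a : vec) : 0 < q <= k ->
  \sum_(j : {ffun 'I_D.+1 -> 'I_(nsub k)})
     ((lab_at f (fun i => j i) == c) && [forall i, q %| a i + j i * step k])
  = density k q.
Proof.
move=> qk; have qt := @coprime_step D A a0 A_large k q qk; have /andP[q0 qk'] := qk.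
have qs : q %| (k.+1)`! by rewrite dvdn_fact // q0 leqW.
have qn : q %| nsub k by rewrite nsub_eq dvdn_mulr.
rewrite sum_ffun_recl exchange_big /=.
transitivity (\sum_(J : {ffun 'I_D -> 'I_(nsub k)})
   ((k.+1)`! %/ q) * [forall i, q %| a (lift ord0 i) + J i * step k]); last first.
  rewrite -big_distrr /=; congr muln.
  rewrite (sum_ffun_forall (fun i (j : 'I_(nsub k)) => q %| a (lift ord0 i) + j * step k)).
  under eq_bigr do rewrite sum_dvdn_lin //.
  by rewrite prod_nat_const card_ord.
apply: eq_bigr => J _; set b := [forall i, _].
pose F x : nat := (lab_at f (vcons x (fun i => J i : nat)) == c)
   && ((q %| a ord0 + x * step k) && b).
transitivity (\sum_(x < nsub k) F x).
  apply: eq_bigr => x _; rewrite /F; congr (nat_of_bool (_ && _)).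
    congr (lab_at f _ == c); apply/boolp.funext => i.
    by rewrite ffunE /vcons; case: unlift.
  rewrite forall_ord_recl ffunE vcons0; congr andb.
  by apply: eq_forallb => i; rewrite ffunE vconsS.
have -> : nsub k = #|lab k| * (k.+1)`! by rewrite mulnC nsub_eq.
rewrite (big_ord_mul _ _ F) exchange_big /=.
transitivity (\sum_(r < (k.+1)`!) (q %| a ord0 + r * step k) * b); last first.
  by rewrite -big_distrl /= sum_dvdn_lin.
apply: eq_bigr => r _; have s0 : 0 < (k.+1)`! by rewrite fact_gt0.
pose p : {perm lab k} := f (Ordinal (ltn_pmod r (ltn0Sn _)),
  [ffun i => Ordinal (ltn_pmod (J i) (subdiv_gt0 _ _))]).
transitivity (\sum_(i < #|lab k|) ((q %| a ord0 + r * step k) * b) *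
    (p (nth (base_label (level D a0 k)) (enum (lab k)) i) == c)); last first.
  by rewrite -big_distrr /= sum_perm_nth muln1.
apply: eq_bigr => i _; rewrite /F.
have -> : lab_at f (vcons (i * (k.+1)`! + r) (fun i => J i : nat)) =
    p (nth (base_label (level D a0 k)) (enum (lab k)) i).
  have rs : r %% (k.+1)`! = r by rewrite modn_small.
  have js : i * (k.+1)`! + r < nsub k.
    rewrite nsub_eq [X in _ < X]mulnC; apply: (@leq_trans (i.+1 * (k.+1)`!)).
      by rewrite mulSnr ltn_add2l.
    by rewrite leq_mul2r (ltn_ord i) orbT.
  rewrite /lab_at /label_at vcons0 -/(nsub k) (modn_small js).
  congr (fun_of_perm (fun_of_fin f _) (nth _ _ _)).
    congr pair; first by apply: val_inj; rewrite /= prednK // modnMDl.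
    by apply/ffunP => l; rewrite !ffunE; apply: val_inj; rewrite /= vconsS.
  by rewrite prednK // divnMDl // divn_small // addn0.
have -> : (q %| a ord0 + (i * (k.+1)`! + r) * step k) = (q %| a ord0 + r * step k).
  rewrite mulnDl addnCA dvdn_addr //.
  by apply/dvdn_mulr/dvdn_mull.
by rewrite mulnb mulnb andbC.
Qed.

(** * Full tiles inside a window *)

Section Tiles.
Variables (k K L : nat) (p : vec).
Hypothesis kK : k.+1 <= K.
Hypothesis pL : forall i, p i + L <= side K.

(** Starts are independent in the different directions, so the full level-[k.+1] copies in the
    window are the products of these one-dimensional starts. *)
Definition tile i (z : 'I_L) := start D a0 k.+1 K (p i + z) && (z + side k.+1 <= L).

(** By [start_gap], each site at distance at least [side k.+1] from both ends lies in a copy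
    prolonged by one site, and that copy fits into the window. *)
Lemma card_tile i : L <= #|tile i| * (side k.+1).+1 + 2 * side k.+1.
Proof.
set m := side k.+1.
have [Lm|Lm] := leqP L (2 * m); first by rewrite (leq_trans Lm) ?leq_addl.
have L0 : 0 < L - 2 * m by rewrite subn_gt0.
(* The map only has to be onto, so the default value of [insubd] does no harm. *)
pose f (x : 'I_L * 'I_m.+1) : 'I_(L - 2 * m) := insubd (Ordinal L0) (x.1 + x.2 - m).
have : [set: 'I_(L - 2 * m)] \subset f @: finset.setX [set z | tile i z] [set: 'I_m.+1].
  apply/fintype.subsetP => u _; have ul := ltn_ord u.
  have um : p i + (u + m) < side K by have := pL i; lia.
  have [s sS /andP[s1 s2]] := start_gap A_large kK um; rewrite -/m in s2.
  have zL : s - p i < L by lia.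
  have oL : u + m - (s - p i) < m.+1 by lia.
  apply/imsetP; exists (Ordinal zL, Ordinal oL).
    rewrite !inE /tile /= ?andbT -/m; have -> : p i + (s - p i) = s by lia.
    by rewrite sS; lia.
  apply: val_inj; rewrite /f val_insubd /=.
  have -> : s - p i + (u + m - (s - p i)) - m = u by lia.
  by rewrite ul.
move=> /subset_leq_card; rewrite cardsT card_ord => /leq_trans/(_ (leq_imset_card _ _)).
by rewrite cardsX cardsT card_ord cardsE addnC -leq_subLR.
Qed.

End Tiles.

(** * Visits to a local event inside a window *)

Section Window.
Variables (k q R : nat) (phi : (vec -> A) -> bool).
Hypothesis qk : 0 < q <= k.
Hypothesis phi_local : forall g g' : vec -> A,
  (forall h, (forall i, h i <= R) -> g h = g' h) -> phi g = phi g'.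

(* The number, per direction, of offsets at which a window of diameter [R] stays
   inside a level-[k] block. *)
Definition core := side k - R.

(** Times [density k q], this is the number of visits at core positions of one full level-[k.+1]
    tile, whatever the tile and its position modulo [q] (see [tile_count]). *)
Definition mean : nat :=
  \sum_(u : {ffun 'I_D.+1 -> 'I_core}) \sum_(c : lab k)
    phi (fun h => cont c (fun i => u i + h i)).

Definition visits (w : vec -> A) (L : nat) : nat :=
  \sum_(v : {ffun 'I_D.+1 -> 'I_L})
    ([forall i, q %| v i] && phi (fun h => w (fun i => v i + h i))).

Variables (w : vec -> A) (L K : nat) (c : lab K) (p : vec).
Hypothesis kK : k.+1 <= K.
Hypothesis wE : forall v, (forall i, v i < L) -> w v = cont c (fun i => p i + v i).

Local Notation tile := (@tile k K L p).
Local Notation idx n := {ffun 'I_D.+1 -> 'I_n}.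

(** The three components are the start of a tile, the index of a level-[k] copy in it, and an offset
    in the core of that copy. On [in_tile] the default of [insubd] is never reached. *)
Definition core_pos (x : idx L * (idx (nsub k) * idx core)) : idx L :=
  [ffun i => insubd (x.1 i) (x.1 i + x.2.1 i * step k + x.2.2 i)].

Definition in_tile : pred (idx L * (idx (nsub k) * idx core)) :=
  [pred x : idx L * (idx (nsub k) * idx core) | [forall i, tile i (x.1 i)]].

Lemma sub_pos_lt (j : 'I_(nsub k)) (u : 'I_core) h : h <= R ->
  j * step k + u + h < side k.+1.
Proof.
move=> hR; have := ltn_ord j; have := ltn_ord u; rewrite /core (sideS D a0 A_large).
by have := sideE D a0 A_large k; nia.
Qed.

Lemma core_posE x i : x \in in_tile ->
  core_pos x i = x.1 i + x.2.1 i * step k + x.2.2 i :> nat.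
Proof.
rewrite inE => /forallP/(_ i)/andP[_ xL].
have lt : x.1 i + x.2.1 i * step k + x.2.2 i < L.
  by have := sub_pos_lt (x.2.1 i) (x.2.2 i) (leq0n R); lia.
by rewrite ffunE val_insubd lt.
Qed.

Lemma core_pos_inj : {in in_tile &, injective core_pos}.
Proof.
move=> x y xT yT /ffunP xy.
have E i : (x.1 i = y.1 i :> nat) /\ (x.2.1 i = y.2.1 i :> nat) /\ (x.2.2 i = y.2.2 i :> nat).
  have := congr1 val (xy i); rewrite /= !core_posE // => {}xy.
  have /forallP/(_ i)/andP[sx _] := xT; have /forallP/(_ i)/andP[sy _] := yT.
  have bx := sub_pos_lt (x.2.1 i) (x.2.2 i) (leq0n R).
  have by_ := sub_pos_lt (y.2.1 i) (y.2.2 i) (leq0n R).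
  have Exy : x.1 i = y.1 i :> nat.
    have [lt|lt|//] := ltngtP (x.1 i) (y.1 i).
      by have := start_sep A_large kK sx sy; rewrite ltn_add2l => /(_ lt); lia.
    by have := start_sep A_large kK sy sx; rewrite ltn_add2l => /(_ lt); lia.
  rewrite Exy in xy *; split=> //.
  have uy : y.2.2 i < side k := leq_trans (ltn_ord _) (leq_subr _ _).
  have ux : x.2.2 i < side k := leq_trans (ltn_ord _) (leq_subr _ _).
  have := sideE D a0 A_large k => S.
  have Ej : x.2.1 i = y.2.1 i :> nat.
    have [lt|lt|//] := ltngtP (x.2.1 i) (y.2.1 i).
      by have := leq_mul lt (leqnn (step k)); rewrite mulSnr; lia.
    by have := leq_mul lt (leqnn (step k)); rewrite mulSnr; lia.
  by split => //; rewrite Ej in xy; lia.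
case: x y E {xT yT xy} => [x1 [x2 x3]] [y1 [y2 y3]] /= E.
by congr (_, (_, _)); apply/ffunP => i; apply: val_inj; have [? []] := E i.
Qed.

Definition ntiles := \prod_i #|tile i|.

Lemma card_in_tile : #|in_tile| = ntiles * (nsub k ^ D.+1 * core ^ D.+1).
Proof.
rewrite -sum1_card.
transitivity (\sum_(z : idx L) \sum_(ju : idx (nsub k) * idx core) [forall i, tile i (z i)]).
  by rewrite pair_bigA /= -big_mkcond; apply: eq_bigl => x; rewrite inE.
transitivity (\sum_(z : idx L) [forall i, tile i (z i)] * (nsub k ^ D.+1 * core ^ D.+1)).
  apply: eq_bigr => z _.
  by rewrite sum_nat_const card_prod !card_ffun !card_ord mulnC.
rewrite -big_distrl /= sum_ffun_forall; congr muln; apply: eq_bigr => i _.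
exact: sum_pred_card.
Qed.

(** At a fixed core offset [u], only the label of the copy [j] decides about [phi]. By [count_label]
    with [a i = z i + u i], each label is met [density k q] times at positions divisible by [q]. *)
Lemma tile_count (z : idx L) (u : idx core) : [forall i, tile i (z i)] ->
  \sum_(j : idx (nsub k))
     ([forall i, q %| core_pos (z, (j, u)) i] &&
      phi (fun h => w (fun i => core_pos (z, (j, u)) i + h i))) =
  density k q * \sum_(c : lab k) phi (fun h => cont c (fun i => u i + h i)).
Proof.
move=> zT; have [|f Hf] := start_content A_large c (p := fun i => p i + z i) kK.
  by move=> i; have /forallP/(_ i)/andP[] := zT.
have zL i : z i + side k.+1 <= L by have /forallP/(_ i)/andP[] := zT.
rewrite big_distrr /=.
transitivity (\sum_(j : idx (nsub k)) \sum_(c : lab k)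
  ((lab_at f (fun i => j i) == c) && [forall i, q %| (z i + u i) + j i * step k])
   * phi (fun h => cont c (fun i => u i + h i))); last first.
  rewrite exchange_big; apply: eq_bigr => c' _; rewrite -big_distrl /=.
  by rewrite (@count_label k f c' q (fun i => z i + u i) qk).
apply: eq_bigr => j _; rewrite (bigD1 (lab_at f (fun i => j i))) //= eqxx /=.
rewrite big1 ?addn0; last by move=> c' /negPf; rewrite eq_sym => ->.
rewrite mulnb; congr (nat_of_bool (_ && _)).
  by apply: eq_forallb => i; rewrite core_posE // addnAC.
apply: phi_local => h hR.
have hm i : j i * step k + u i + h i < side k.+1 by apply: sub_pos_lt.
rewrite wE; last by move=> i; rewrite core_posE //=; have := zL i; have := hm i; lia.
transitivity (cont c (fun i => p i + z i + (j i * step k + u i + h i))).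
  by congr (cont c _); apply/boolp.funext => i; rewrite core_posE //=; lia.
rewrite Hf // contS.
have uh i : u i + h i < step k.
  by have := ltn_ord (u i); rewrite /core; have := sideE D a0 A_large k; have := hR i; lia.
congr (cont (lab_at f _) _); apply/boolp.funext => i; rewrite -addnA.
  by rewrite divnMDl ?(step_gt0 D a0 A_large) // divn_small ?addn0.
by rewrite modnMDl modn_small.
Qed.

(* All full level-[k.+1] tiles contribute the same number of visits, up to the
   positions outside their cores, whose number is the difference of the two
   bounds. *)
Lemma window_count :
  ntiles * (density k q * mean) <= visits w L /\
  visits w L + ntiles * (nsub k ^ D.+1 * core ^ D.+1) <=
  ntiles * (density k q * mean) + L ^ D.+1.
Proof.
set F := fun v : idx L => [forall i, q %| v i] && phi (fun h => w (fun i => v i + h i)).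
pose G := core_pos @: in_tile.
have GE : \sum_(v in G) F v = ntiles * (density k q * mean).
  rewrite big_imset /=; last exact: core_pos_inj.
  transitivity (\sum_(z : idx L | [forall i, tile i (z i)])
     \sum_(ju : idx (nsub k) * idx core) F (core_pos (z, ju))).
    by rewrite pair_big_dep /=; apply: eq_big => [x|[z ju] _] //; rewrite !inE andbT.
  transitivity (\sum_(z : idx L | [forall i, tile i (z i)]) density k q * mean); last first.
    rewrite big_mkcond /=.
    transitivity (\sum_(z : idx L) [forall i, tile i (z i)] * (density k q * mean)).
      by apply: eq_bigr => z _; case: ifP; rewrite ?mul1n.
    rewrite -big_distrl /= sum_ffun_forall; congr muln; apply: eq_bigr => i _.
    exact: sum_pred_card.
  apply: eq_bigr => z zT; rewrite -(pair_bigA _ (fun j u => F (core_pos (z, (j, u))) : nat)) /=.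
  by rewrite exchange_big /mean big_distrr /=; apply: eq_bigr => u _; apply: tile_count.
have -> : visits w L = \sum_(v in G) F v + \sum_(v in ~: G) F v.
  rewrite /visits (bigID (mem G)) /=; congr addn.
  by apply: eq_bigl => v; rewrite inE.
rewrite GE leq_addr; split => //; rewrite -addnA leq_add2l.
have <- : #|G| + #|~: G| = L ^ D.+1 by rewrite cardsC card_ffun !card_ord.
rewrite -card_in_tile card_in_imset; last exact: core_pos_inj.
rewrite addnC leq_add2l -sum1_card; apply: leq_sum => v _; exact: leq_b1.
Qed.

End Window.
End Counting.

(** * The subshift of blocks *)

(** A division-free Bernoulli inequality: relative losses of 1/T in each factor add up to at most
    [#|I|] / T. Truncating the factors at [L] bounds the partial products by powers of [L]. *)
Lemma prod_deficit (I : finType) (T L : nat) (a : I -> nat) :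
  (forall i, T * L <= T * a i + L) ->
  T * L ^ #|I| <= T * \prod_i a i + #|I| * L ^ #|I|.
Proof.
move=> H; pose b i := minn (a i) L.
have Hb i : T * L <= T * b i + L.
  by rewrite /b /minn; have := H i; case: ifP => // _ _; rewrite leq_addr.
have bL i : b i <= L by apply: geq_minr.
apply: (@leq_trans (T * \prod_i b i + #|I| * L ^ #|I|)); last first.
  rewrite leq_add2r; apply: leq_mul => //; apply: leq_prod => i _; exact: geq_minl.
rewrite cardE -big_enum /=.
elim: (enum I) => [|i e IH]; first by rewrite big_nil mul0n addn0.
rewrite big_cons /= expnS.
have P : \prod_(j <- e) b j <= L ^ size e.
  elim: e {IH} => [|j e IH]; first by rewrite big_nil.
  by rewrite big_cons expnS leq_mul.
move: (\prod_(j <- e) b j) (L ^ size e) (size e) (b i) (Hb i) (bL i) IH P => p l n c.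
nia.
Qed.

Lemma leq_expnl a b e : a <= b -> a ^ e <= b ^ e.
Proof. by move=> ab; elim: e => // e IH; rewrite !expnS leq_mul. Qed.

Definition toZ d (v : 'I_d -> nat) : 'rV[int]_d := (\row_i (v i)%:Z)%R.

Lemma toZD d (u v : 'I_d -> nat) : toZ (fun i => u i + v i) = (toZ u + toZ v)%R.
Proof. by apply/rowP => i; rewrite !mxE PoszD. Qed.

Section Shift.
Variables (D : nat) (A : finType) (a0 : A).
Hypothesis A_large : 3 < #|A|.
Local Notation vec := ('I_D.+1 -> nat).
Local Notation lab := (lab D a0).
Local Notation step := (step D a0).
Local Notation nsub := (nsub D a0).
Local Notation side := (side D a0).
Local Notation rv := 'rV[int]_D.+1.

Definition block_shift (x : rv -> A) : Prop := forall (b : rv) (L : nat),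
  exists (K : nat) (c : lab K) (p : vec), (forall i, p i + L <= side K) /\
    forall v : vec, (forall i, v i < L) -> x (b + toZ v)%R = cont c (fun i => p i + v i).

Lemma block_shift_translate g x : block_shift x -> block_shift (fun h => x (g + h)%R).
Proof.
move=> H b L; have [K [c [p [pL E]]]] := H (g + b)%R L.
by exists K, c, p; split=> // v /E <-; rewrite addrA.
Qed.

Lemma block_shift_closed x :
  (forall (b : rv) (L : nat), exists2 y, block_shift y &
    forall v : vec, (forall i, v i < L) -> x (b + toZ v)%R = y (b + toZ v)%R) -> block_shift x.
Proof.
move=> H b L; have [y yS E] := H b L; have [K [c [p [pL E']]]] := yS b L.
by exists K, c, p; split=> // v vL; rewrite E // E'.
Qed.

Lemma leq_side_lt k K : side k < side K -> k < K.
Proof. by rewrite !ltnNge; apply: contra => /(leq_side D a0 A_large). Qed.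

Lemma mean_le k R (phi : (vec -> A) -> bool) q : 0 < q ->
  density D a0 k q * mean a0 k R phi <= nsub k ^ D.+1 * core D a0 k R ^ D.+1.
Proof.
move=> q0; apply: (@leq_trans (density D a0 k q * (#|lab k| * core D a0 k R ^ D.+1))).
  rewrite leq_mul2l; apply/orP; right; rewrite /mean.
  apply: (@leq_trans (\sum_(u : {ffun 'I_D.+1 -> 'I_(core D a0 k R)}) \sum_(c : lab k) 1)).
    by apply: leq_sum => u _; apply: leq_sum => c _; apply: leq_b1.
  by rewrite !sum_nat_const card_ffun !card_ord muln1 mulnC.
rewrite mulnA; apply: leq_mul => //; rewrite /density expnS mulnAC.
apply: leq_mul; first by rewrite nsub_eq leq_mul2r leq_div orbT.
by apply: leq_expnl; apply: leq_div.
Qed.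

(** Uniform convergence of frequencies along [q Z^d], without division. For large [k] the cores fill
    most of each tile, and for large [L] the tiles fill most of the window; by [window_count], only
    the remaining sites can distinguish [x] from [y]. *)
Lemma uniform_visits q R (phi : (vec -> A) -> bool) T : 0 < q -> 0 < T ->
  (forall g g' : vec -> A, (forall h, (forall i, h i <= R) -> g h = g' h) -> phi g = phi g') ->
  exists L0, forall L x y, L0 <= L -> block_shift x -> block_shift y ->
    T * visits q phi (fun v => x (toZ v)) L <=
    T * visits q phi (fun v => y (toZ v)) L + L ^ D.+1.
Proof.
(* A loss of 1/T' is allowed in each direction, because [prod_deficit] multiplies it by [D.+1]. *)
move=> q0 T0 phiL; pose T' := D.+1 * T.
pose k := q + (2 * T' * (R + 2) + R + 1).
have qk : 0 < q <= k by rewrite q0 leq_addr.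
set m := side k.+1.
have m0 : 0 < m := side_gt0 D a0 A_large _.
have T'0 : 0 < T' by rewrite muln_gt0.
exists (4 * m * T') => L x0 y0 Lm.
have main x : block_shift x -> exists N,
  [/\ N * (density D a0 k q * mean a0 k R phi) <= visits q phi (fun v => x (toZ v)) L,
   visits q phi (fun v => x (toZ v)) L + N * (nsub k ^ D.+1 * core D a0 k R ^ D.+1) <=
   N * (density D a0 k q * mean a0 k R phi) + L ^ D.+1 &
   T * L ^ D.+1 <= T * (N * (nsub k ^ D.+1 * core D a0 k R ^ D.+1)) + L ^ D.+1].
  move=> /(_ 0%R L)[K [c [p [pL E]]]].
  have kK : k.+1 <= K.
    apply: ltnW; apply: leq_side_lt; rewrite -/m; have := pL ord0; nia.
  have E' (v : vec) : (forall i, v i < L) -> x (toZ v) = cont c (fun i => p i + v i).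
    by move=> /E <-; rewrite add0r.
  have [lo hi] := window_count A_large qk phiL kK E'.
  exists (ntiles a0 k L K p); split=> //.
  set n := nsub k; set l := core D a0 k R.
  have tl : 2 * T' * (R + 2) <= l.
    rewrite /l /core; have := sideE D a0 A_large k; have := step_ge D a0 A_large k.
    by have := ltn_expl k (ltnSn 1); rewrite /k; case: odd => /=; lia.
  have ml : m.+1 <= n * l + n * (R + 2).
    rewrite /m (sideS D a0 A_large) /l /core -/n; have := sideE D a0 A_large k.
    have := nsub_gt0 D a0 k; rewrite -/n => n0; case: odd => /=; nia.
  (* Half of the allowed loss [L] covers the two end strips, by the choice of the threshold
     [4 * m * T']; the other half covers the sites outside the cores, by the choice of [k]. *)
  have H1 i : T' * L <= T' * (#|tile a0 k K p i (L := L)| * (n * l)) + L.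
    have := card_tile A_large kK pL i; rewrite -/m.
    set N := #|_|; move=> NL.
    have [big|small] := leqP L (N * (n * l)); first by nia.
    have H2 : 2 * T' * (N * (n * (R + 2))) <= L.
      have := leq_mul (leqnn (N * n)) tl; nia.
    have H3 : N * m.+1 <= N * (n * l) + N * (n * (R + 2)) by rewrite -mulnDr leq_mul2l ml orbT.
    move: (N * m.+1) (N * (n * l)) (N * (n * (R + 2))) NL H2 H3 small => A1 A2 A3; nia.
  have := prod_deficit H1.
  rewrite card_ord big_split /= prod_nat_const card_ord expnMn -/(ntiles _ _ _ _).
  rewrite /T' -!mulnA -mulnDr leq_mul2l //=.
move=> /main[Nx [_ hx dx]] /main[Ny [ly _ dy]].
have := mean_le k R phi q0.
move: (density D a0 k q * mean a0 k R phi) (nsub k ^ D.+1 * core D a0 k R ^ D.+1)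
  hx dx ly dy => kP Q hx dx ly dy kQ.
move: (visits _ _ _ _) (visits _ _ _ _) (L ^ D.+1) hx dx ly dy => Sy Sx LD hx dx ly dy.
have [le|/ltnW le] := leqP Nx Ny.
  have : Nx * kP <= Ny * kP by rewrite leq_mul2r le orbT.
  have := leq_mul (leqnn T) hx; have := leq_mul (leqnn T) ly.
  nia.
(* The additional tiles of [x] bring at most [(Nx - Ny) * Q] visits, by [mean_le], and the sites not
   covered in [y] account for them. *)
have : Nx * kP + Ny * Q <= Ny * kP + Nx * Q by nia.
nia.
Qed.


Lemma label_occurs k q (f : lab k.+1) (c : lab k) (a : vec) : 0 < q <= k ->
  exists2 j : vec, (forall i, j i < nsub k) /\ lab_at f j = c &
    forall i, q %| a i + j i * step k.
Proof.
move=> qk; have := count_label A_large f c a qk; have /andP[q0 qk'] := qk.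
have fq : q <= (k.+1)`! by rewrite (leq_trans (leqW qk')) // leq_fact.
have nq : q <= nsub k.
  rewrite nsub_eq (leq_trans fq) // leq_pmulr // (leq_trans _ (card_lab D a0 k)) //.
  exact/ltnW/ltnW/ltnW.
have : 0 < density D a0 k q by rewrite muln_gt0 expn_gt0 !divn_gt0 // fq nq.
move=> /[swap] <-; rewrite lt0n sum_nat_eq0 negb_forall => /existsP[j].
rewrite eqb0 negbK => /andP[/eqP jc /forallP ja].
by exists (fun i => j i : nat) => //; split.
Qed.

(** Every large window contains a full level-[k.+1] tile, and in it the label [c] occurs in every
    residue class modulo [q]. *)
Lemma block_occurs x k q (c : lab k) (p : vec) : block_shift x -> 0 < q <= k ->
  exists2 s : vec, (forall i, q %| s i + p i) &
    forall v : vec, (forall i, v i < side k) -> x (toZ (fun i => s i + v i)) = cont c v.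
Proof.
move=> xS qk; set m := side k.+1.
have m0 : 0 < m := side_gt0 D a0 A_large _.
(* This is the least side for which the bound of [card_tile] forces a tile. *)
have [K [c' [p' [pL E]]]] := xS 0%R (2 * m).+1.
have kK : k.+1 <= K by apply: ltnW; apply: leq_side_lt; rewrite -/m; have := pL ord0; lia.
have Z i : exists z, [/\ z < (2 * m).+1, start D a0 k.+1 K (p' i + z) & z + m <= (2 * m).+1].
  have := card_tile A_large kK pL i; rewrite -/m => H.
  have /card_gt0P[z /andP[z1 z2]] : 0 < #|tile a0 k K p' i (L := (2 * m).+1)| by nia.
  by exists z; split.
have [z Hz] := boolp.choice Z.
have [|f Hf] := start_content A_large c' (p := fun i => p' i + z i) kK.
  by move=> i; have [] := Hz i.
have [j [jn jc] ja] := label_occurs f c (fun i => z i + p i) qk.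
exists (fun i => z i + j i * step k) => [i|v vk]; first by rewrite addnAC.
have jv i : j i * step k + v i < m.
  have := leq_mul (jn i) (leqnn (step k)); rewrite mulSn /m (sideS D a0 A_large).
  by have := sideE D a0 A_large k; have := vk i; lia.
rewrite -(add0r (toZ _)) E; last by move=> i; have [_ _] := Hz i; have := jv i; lia.
transitivity (cont c' (fun i => p' i + z i + (j i * step k + v i))).
  by congr (cont c' _); apply/boolp.funext => i; lia.
rewrite Hf // contS -jc.
have vs i : v i < step k by have := sideE D a0 A_large k; have := vk i; lia.
congr (cont (lab_at f _) _); apply/boolp.funext => i.
  by rewrite divnMDl ?(step_gt0 D a0 A_large) // divn_small ?addn0.
by rewrite modnMDl modn_small.
Qed.

(** The source of minimality along [q Z^d]: the pattern of [y] sits in a block, which [block_occurs]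
    finds in [x] in the required residue class. *)
Lemma pattern_recurs q x y b L : 0 < q -> block_shift x -> block_shift y ->
  exists2 s : vec, (forall i, q %| s i) &
    forall v : vec, (forall i, v i < L) -> x (toZ (fun i => s i + v i)) = y (b + toZ v)%R.
Proof.
(* The enlargement by [(side q).+1] forces the level [K] to exceed [q]. *)
move=> q0 xS yS; have [K [c [p [pL E]]]] := yS b (L + (side q).+1).
have qK : 0 < q <= K by rewrite q0; apply/ltnW/leq_side_lt; have := pL ord0; lia.
have [s sq sE] := block_occurs c p xS qK.
exists (fun i => s i + p i) => // v vL; rewrite E; last by move=> i; rewrite ltn_addr.
rewrite -sE; last by move=> i; have := pL i; have := vL i; lia.
by congr (x (toZ _)); apply/boolp.funext => i; rewrite addnA.
Qed.

(** Needed for entropy: different labels count as different patterns. Sub-blocks determine their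
    labels by induction, and every value of every permutation of an arrangement is read off at some
    index. *)
Lemma cont_inj k (c c' : lab k) :
  (forall v : vec, (forall i, v i < side k) -> cont c v = cont c' v) -> c = c'.
Proof.
elim: k c c' => [c c' H|k IH f f' H]; first exact: (H (fun=> 0) (fun=> ltn0Sn _)).
have E (j : vec) : (forall i, j i < nsub k) -> lab_at f j = lab_at f' j.
  move=> jn; apply: IH => u uk.
  have us i : u i < step k by have := sideE D a0 A_large k; have := uk i; lia.
  have := H (fun i => j i * step k + u i); rewrite !contS.
  have -> : (fun i => (j i * step k + u i) %/ step k) = j.
    by apply/boolp.funext => i; rewrite divnMDl ?(step_gt0 D a0 A_large) // divn_small ?addn0.
  have -> : (fun i => (j i * step k + u i) %% step k) = u.
    by apply/boolp.funext => i; rewrite modnMDl modn_small.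
  apply=> i; have := leq_mul (jn i) (leqnn (step k)); rewrite mulSn (sideS D a0 A_large).
  by have := sideE D a0 A_large k; have := uk i; lia.
have s0 : 0 < (k.+1)`! by rewrite fact_gt0.
apply/ffunP => -[r J]; apply/permP => l.
pose i := enum_rank l.
have rs : r < (k.+1)`! by rewrite -[X in _ < X]prednK //; apply: ltn_ord.
pose j : vec := vcons (i * (k.+1)`! + r) (fun i => J i).
have j0 : i * (k.+1)`! + r < nsub k.
  rewrite nsub_eq [X in _ < X]mulnC; apply: (@leq_trans (i.+1 * (k.+1)`!)).
    by rewrite mulSnr ltn_add2l.
  by rewrite leq_mul2r (ltn_ord i) orbT.
have jn i' : j i' < nsub k.
  by rewrite /j; case: (unliftP ord0 i') => [i''|] ->; rewrite ?vconsS ?vcons0.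
have := E j jn; rewrite /lab_at /label_at /j vcons0 -/(nsub k) (modn_small j0).
have -> : Ordinal (ltn_pmod (i * (k.+1)`! + r) (ltn0Sn (k.+1)`!.-1)) = r.
  by apply: val_inj; rewrite /= [X in _ %% X]prednK // modnMDl modn_small.
set J' := [ffun _ => _]; have -> : J' = J.
  by apply/ffunP => l'; rewrite !ffunE; apply: val_inj; rewrite /= vconsS modn_small.
have -> : (i * (k.+1)`! + r) %/ (k.+1)`!.-1.+1 = i.
  by rewrite [X in _ %/ X]prednK // divnMDl // divn_small // addn0.
by rewrite -(enum_val_nth _ i) /i enum_rankK.
Qed.

End Shift.

Local Open Scope classical_set_scope.
Local Open Scope ring_scope.

(** * Subshifts as compact metric spaces *)

Section Windows.
Variables (d : nat) (A : eqType).
Local Notation conf := ('rV[int]_d -> A).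

(** A finite parametrisation of [[-n, n]^d], which makes [agree] boolean, so that the least radius
    of disagreement can be taken in [first_inv]. *)
Definition window n (f : {ffun 'I_d -> 'I_n.*2.+1}) : 'rV[int]_d :=
  \row_i ((f i)%:Z - n%:Z).

Lemma window_bound n f i : (`|@window n f ord0 i| <= n)%N.
Proof. by rewrite mxE; have := ltn_ord (f i); lia. Qed.

Lemma windowP n (g : 'rV[int]_d) : (forall i, (`|g ord0 i| <= n)%N) ->
  exists f, g = @window n f.
Proof.
move=> gn; exists [ffun i => inord (absz (g ord0 i + n%:Z))].
apply/rowP => i; rewrite mxE ffunE inordK; have := gn i; rewrite -?addnn.
  by move: (g ord0 i) => z; lia.
by move: (g ord0 i) => z; lia.
Qed.

Definition agree n (x y : conf) : bool := [forall f, x (@window n f) == y (@window n f)].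

Lemma agreeP n x y :
  reflect (forall g : 'rV[int]_d, (forall i, (`|g ord0 i| <= n)%N) -> x g = y g) (agree n x y).
Proof.
apply: (iffP forallP) => [H g /windowP[f ->]|H f]; first exact/eqP.
by apply/eqP/H => i; exact: window_bound.
Qed.

Lemma agreexx n x : agree n x x. Proof. exact/agreeP. Qed.

Lemma agree_sym n x y : agree n x y = agree n y x.
Proof. by apply: eq_forallb => f; rewrite eq_sym. Qed.

Lemma agree_trans n x y z : agree n x y -> agree n y z -> agree n x z.
Proof. by move=> /agreeP xy /agreeP yz; apply/agreeP => g gn; rewrite xy // yz. Qed.

Lemma leq_agree m n x y : (m <= n)%N -> agree n x y -> agree m x y.
Proof.
move=> mn /agreeP xy; apply/agreeP => g gm.
by apply: xy => i; apply: leq_trans (gm i) mn.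
Qed.

Definition radius (g : 'rV[int]_d) : nat := \max_i `|g ord0 i|%N.

Lemma radius_ge (g : 'rV[int]_d) i : (`|g ord0 i| <= radius g)%N.
Proof. exact: (@leq_bigmax _ (fun i : 'I_d => absz (g ord0 i))). Qed.

Lemma agree_all x y : (forall n, agree n x y) -> x = y.
Proof.
move=> xy; apply/funext => g; have /agreeP := xy (radius g); apply => i.
exact: radius_ge.
Qed.

Lemma agree_shift n g x y : agree (n + radius g) x y ->
  agree n (fun h => x (g + h)) (fun h => y (g + h)).
Proof.
move=> /agreeP xy; apply/agreeP => h hn; apply: xy => i.
by rewrite mxE; have := hn i; have := radius_ge g i; move: (g ord0 i) (h ord0 i) => a b; lia.
Qed.

End Windows.

Record subshift (d : nat) (A : finType) := Subshift {
  config : set ('rV[int]_d -> A);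
  config_point : 'rV[int]_d -> A;
  config_pointP : config config_point;
  config_shift : forall g x, config x -> config (fun h => x (g + h));
  config_closed : forall x, (forall n, exists2 y, config y & agree n x y) -> config x }.

Definition shift_space (R : realType) d A (S : subshift d A) : Type :=
  {x : 'rV[int]_d -> A | config S x}.

HB.instance Definition _ R d A (S : subshift d A) := gen_eqMixin (shift_space R S).
HB.instance Definition _ R d A (S : subshift d A) := gen_choiceMixin (shift_space R S).

Section Metric.
Variables (R : realType) (d : nat) (A : finType) (S : subshift d A).
Local Notation X := (shift_space R S).
Implicit Types x y z : X.

Definition first_inv (P : pred nat) : R :=
  if pselect (exists n, P n) is left h then (ex_minn h).+1%:R^-1 else 0.

(** The usual ultrametric on configurations. *)
Definition sdist x y : R := first_inv (fun n => ~~ agree n (sval x) (sval y)).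

Lemma sdist_lt n x y : (sdist x y < n.+1%:R^-1) = agree n (sval x) (sval y).
Proof.
rewrite /sdist /first_inv; case: pselect => [h|h]; last first.
  rewrite invr_gt0 ltr0n /=; apply/esym/negP => /negP ?; apply: h; by exists n.
case: ex_minnP => m nm mmin; rewrite ltf_pV2 ?posrE ?ltr0n // ltr_nat ltnS.
apply/idP/idP => [nm'|xy].
  by apply/negPn/negP => /mmin; rewrite leqNgt nm'.
by rewrite ltnNge; apply/negP => /leq_agree/(_ xy); apply/negP.
Qed.

Lemma sdistxx x : sdist x x = 0.
Proof.
rewrite /sdist /first_inv; case: pselect => // h; exfalso.
by case: h => n; rewrite agreexx.
Qed.

Lemma sdist_eq0 x y : sdist x y = 0 -> x = y.
Proof.
move=> xy; case: x y xy => [x Hx] [y Hy] xy.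
suff E : x = y by rewrite E in Hx xy *; congr exist; exact: Prop_irrelevance.
by apply: agree_all => n; rewrite -[x]/(sval (exist _ x Hx)) -[y]/(sval (exist _ y Hy))
  -sdist_lt xy invr_gt0 ltr0n.
Qed.

Lemma sdist_sym x y : sdist x y = sdist y x.
Proof.
by rewrite /sdist; congr first_inv; apply/funext => n; rewrite agree_sym.
Qed.

Lemma sdist_ge0 x y : 0 <= sdist x y.
Proof. by rewrite /sdist /first_inv; case: pselect => // h; rewrite invr_ge0 ler0n. Qed.

Lemma sdist_triangle y x z : sdist x z <= sdist x y + sdist y z.
Proof.
rewrite {1}/sdist /first_inv; case: pselect => [h|_]; last by rewrite addr_ge0 ?sdist_ge0.
case: ex_minnP => m nm _.
have [xy|xy] := boolP (agree m (sval x) (sval y)); last first.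
  by rewrite -[leLHS]addr0 lerD ?sdist_ge0 // leNgt sdist_lt.
have [yz|yz] := boolP (agree m (sval y) (sval z)).
  by rewrite (agree_trans xy yz) in nm.
by rewrite -[leLHS]add0r lerD ?sdist_ge0 // leNgt sdist_lt.
Qed.

HB.instance Definition _ := isMetric.Build R X sdistxx sdist_eq0 sdist_sym sdist_triangle.
HB.instance Definition _ := isPointed.Build X (exist _ _ (config_pointP S)).

Lemma nbhs_agree x (P : set X) :
  nbhs x P <-> exists n, forall y, agree n (sval x) (sval y) -> P y.
Proof.
rewrite -nbhs_ballE; split => [[e /= e0 H]|[n H]].
  have [n ne] : exists n, n.+1%:R^-1 < e.
    exists (Num.trunc e^-1).
    by rewrite invf_plt ?posrE ?ltr0n // truncnS_gt.
  exists n => y xy; apply: H; rewrite ballEmdist /=.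
  by apply: lt_trans ne; rewrite sdist_lt.
exists n.+1%:R^-1 => /=; first by rewrite invr_gt0 ltr0n.
by move=> y; rewrite ballEmdist /= sdist_lt => /H.
Qed.

Definition saction (g : 'rV[int]_d) (x : X) : X :=
  exist _ (fun h => sval x (g + h)) (config_shift g (svalP x)).

Lemma shift_space_inj x y : sval x = sval y -> x = y.
Proof.
case: x y => [x Hx] [y Hy] /= E; rewrite E in Hx *; congr exist; exact: Prop_irrelevance.
Qed.

Lemma saction_action : continuous_action saction.
Proof.
split.
- by apply/funext => x; apply: shift_space_inj; apply/funext => h /=; rewrite add0r.
- move=> g h; apply/funext => x; apply: shift_space_inj; apply/funext => k /=.
  by rewrite [g + h]addrC addrA.
- move=> g x P /nbhs_agree[n H]; apply/nbhs_agree.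
  by exists (n + radius g)%N => y xy; apply: H; apply: agree_shift.
Qed.

Lemma ultra_finite (T : Type) (B : finType) (F : set_system T) (f : T -> B) :
  UltraFilter F -> exists b, F [set t | f t = b].
Proof.
move=> FU; apply: contrapT => H.
have : \forall t \near F, forall b : B, f t <> b.
  apply: (@filter_forall T B (fun b => [set t | f t <> b]) F) => b.
  have [Fb|//] := in_ultra_setVsetC [set t | f t = b] FU.
  by case: H; exists b.
by move=> /filter_ex[t /(_ (f t))].
Qed.

(** An ultrafilter selects one symbol at each site. The resulting configuration agrees on each
    finite window with points of the subshift, hence belongs to it. *)
Lemma shift_space_compact : compact [set: X].
Proof.
rewrite compact_ultra => F FU _.
have [y Hy] := choice (fun g => ultra_finite (fun x : X => sval x g) FU).
have Hn n : F [set x : X | agree n y (sval x)].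
  have : \forall x \near F, forall f, sval x (@window d n f) = y (window f).
    apply: (@filter_forall X _ (fun f => [set x | sval x (@window d n f) = y (window f)]) F).
    by move=> f; exact: Hy.
  by apply: filterS => x H; apply/forallP => f; rewrite H.
have Sy : config S y.
  apply: config_closed => n; have [x xy] := filter_ex (Hn n).
  by exists (sval x) => //; exact: svalP.
exists (exist _ y Sy); split => //= P /nbhs_agree[n H].
by apply: filterS (Hn n) => x /H.
Qed.

End Metric.

(** * Invariant measures *)

Section Cylinders.
Variables (R : realType) (d : nat) (A : finType) (S : subshift d A).
Local Notation X := (shift_space R S).
Implicit Types (x y : X) (B C : set X).

Definition cylinder : set (set X) :=
  [set B | exists n, forall x y, agree n (sval x) (sval y) -> B x -> B y].

Lemma cylinder0 : cylinder set0.
Proof. by exists 0%N. Qed.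

Lemma cylinderC : setC_closed cylinder.
Proof.
move=> B [n Bn]; exists n => x y xy nBx By; apply: nBx; apply: Bn By.
by rewrite agree_sym.
Qed.

Lemma cylinderU : setU_closed cylinder.
Proof.
move=> B C [n Bn] [m Cm]; exists (maxn n m) => x y xy [/Bn By|/Cm Cy].
  by left; apply: By; apply: leq_agree xy; rewrite leq_maxl.
by right; apply: Cy; apply: leq_agree xy; rewrite leq_maxr.
Qed.

Lemma cylinderI : setI_closed cylinder.
Proof.
move=> B C cB cC; rewrite -(setCK (B `&` C)) setCI.
by apply/cylinderC/cylinderU; apply: cylinderC.
Qed.

Lemma cylinder_open B : cylinder B -> open B.
Proof.
move=> [n Bn]; rewrite openE => x Bx; apply/nbhs_agree; exists n => y xy.
exact: Bn Bx.
Qed.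

Lemma cylinder_preimage g B : cylinder B -> cylinder (saction g @^-1` B).
Proof.
move=> [n Bn]; exists (n + radius g)%N => x y xy /=; apply: Bn.
exact: agree_shift.
Qed.

Lemma open_bigcup_cylinder (O : set X) : open O ->
  O = \bigcup_n [set x | forall y, agree n (sval x) (sval y) -> O y].
Proof.
rewrite openE => oO; apply/seteqP; split=> x /=.
  by move=> /oO /nbhs_agree[n On]; exists n.
by move=> [n _ /=]; apply; exact: agreexx.
Qed.

Lemma borel_cylinder : @measurable _ (borel X) = <<s cylinder >>.
Proof.
apply/seteqP; split.
  apply: smallest_sub; first exact: smallest_sigma_algebra.
  move=> O /open_bigcup_cylinder ->; apply: sigma_algebra_bigcup => n.
  apply: sub_sigma_algebra; exists n => x y xy H z yz.
  exact/H/(agree_trans xy).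
apply: smallest_sub; first exact: smallest_sigma_algebra.
by move=> B /cylinder_open oB; apply: sub_sigma_algebra.
Qed.

Lemma cylinder_measurable B : cylinder B -> measurable (B : set (borel X)).
Proof. by move=> cB; rewrite borel_cylinder; apply: sub_sigma_algebra. Qed.

Lemma cylinder_measure_unique (mu nu : probability (borel X) R) :
  (forall B, cylinder B -> mu B = nu B) ->
  forall B : set (borel X), measurable B -> mu B = nu B.
Proof.
move=> H B mB.
have cT : cylinder [set: X] by rewrite -setC0; apply/cylinderC/cylinder0.
apply: (@measure_unique _ R (borel X) cylinder (fun=> setT)
  borel_cylinder cylinderI _ _ mu nu) => //.
- by apply/seteqP; split => // x _; exists 0%N.
- move=> _; have : (mu setT < +oo)%E by rewrite probability_setT ltry.
  exact.
Qed.

End Cylinders.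

Section CylinderType.
Variables (R : realType) (d : nat) (A : finType) (S : subshift d A).

(** A copy of the space whose measurable sets are the cylinders only: the algebra from which the
    Caratheodory extension starts. *)
Definition cylinder_type : Type := shift_space R S.
HB.instance Definition _ := Pointed.on cylinder_type.
HB.instance Definition _ := isAlgebraOfSets.Build default_measure_display cylinder_type
  (@cylinder0 R d A S) (@cylinderU R d A S) (@cylinderC R d A S).
End CylinderType.

Lemma ultra_image (T T' : Type) (F : set_system T) (f : T -> T') :
  UltraFilter F -> UltraFilter (f @ F).
Proof.
move=> FU; split; first exact: fmap_proper_filter.
move=> G GF FG; apply/seteqP; split=> // B GB.
have [//|FnB] := in_ultra_setVsetC (f @^-1` B) FU.
by have := filter_ex (filterI GB (FG (~` B) FnB)) => -[t []].
Qed.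

(** * Limit frequencies along an ultrafilter and the measure they define *)

Section LimitFrequency.
Variables (R : realType) (d : nat) (A : finType) (S : subshift d A).
Local Notation X := (shift_space R S).
Implicit Types (x y : X) (B C : set X).

Definition hits q (B : set X) (x : X) (L : nat) : nat :=
  \sum_(v : {ffun 'I_d -> 'I_L})
    ([forall i, q %| v i] && `[< B (saction (toZ (fun i => v i)) x) >])%N.

(** With side [L.+1] the box is never empty, so the whole space has frequency 1 for every [L]. *)
Definition freq B x (L : nat) : R := (hits 1 B x L.+1)%:R / (L.+1 ^ d)%:R.

Lemma hits_le q B x L : (hits q B x L <= L ^ d)%N.
Proof.
apply: (@leq_trans (\sum_(v : {ffun 'I_d -> 'I_L}) 1)%N).
  by apply: leq_sum => v _; apply: leq_b1.
by rewrite sum_nat_const muln1 card_ffun !card_ord.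
Qed.

Lemma freq_itv B x L : `[0, 1]%classic (freq B x L).
Proof.
have L0 : (0 : R) < (L.+1 ^ d)%:R by rewrite ltr0n expn_gt0.
rewrite /= in_itv /= /freq divr_ge0 ?ler0n // ler_pdivrMr // mul1r ler_nat.
exact: hits_le.
Qed.

Lemma hitsU q B C x L : B `&` C = set0 ->
  hits q (B `|` C) x L = (hits q B x L + hits q C x L)%N.
Proof.
move=> BC; rewrite /hits -big_split /=; apply: eq_bigr => v _.
case: [forall i, _] => //=; set y := saction _ _.
have : ~ (B `&` C) y by rewrite BC.
have [By|nBy] := pselect (B y); have [Cy|nCy] := pselect (C y) => nBC.
- by case: nBC.
- by rewrite (asboolT By) (asboolF nCy) asboolT //; left.
- by rewrite (asboolF nBy) (asboolT Cy) asboolT //; right.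
- by rewrite (asboolF nBy) (asboolF nCy) asboolF // => -[].
Qed.

Variable x0 : X.
Variable U : set_system nat.
Hypothesis UU : UltraFilter U.

Definition lfreq B : R := lim (freq B x0 @ U).

Lemma lfreq_cvg B : freq B x0 @ U --> lfreq B.
Proof.
have /= := @segment_compact R 0 1; rewrite compact_ultra => /(_ (freq B x0 @ U) _).
case; [exact: ultra_image| |by move=> l [_ lB]; exact: cvgP lB].
change (U [set L | `[0, 1]%classic (freq B x0 L)]).
by apply: filterE => L; exact: freq_itv.
Qed.

Lemma lfreqU B C : B `&` C = set0 -> lfreq (B `|` C) = lfreq B + lfreq C.
Proof.
move=> BC; apply/cvg_lim => //.
have -> : freq (B `|` C) x0 = freq B x0 \+ freq C x0.
  by apply/funext => L; rewrite /freq hitsU // natrD mulrDl.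
by apply: cvgD; exact: lfreq_cvg.
Qed.

Lemma lfreq_ge0 B : 0 <= lfreq B.
Proof.
apply: (cvgr_to_ge (lfreq_cvg (B := B))).
by apply: (@filterE _ U) => L; have := freq_itv B x0 L; rewrite /= in_itv /= => /andP[].
Qed.

Lemma lfreq0 : lfreq set0 = 0.
Proof.
have := @lfreqU set0 set0 (setI0 _); rewrite setU0 => /eqP.
by rewrite -subr_eq0 opprD addNKr oppr_eq0 => /eqP.
Qed.

Lemma lfreqT : lfreq setT = 1.
Proof.
apply/cvg_lim => //; rewrite (_ : freq _ _ = cst 1); first exact: cvg_cst.
apply/funext => L; rewrite /freq (_ : hits _ _ _ _ = (L.+1 ^ d)%N).
  by rewrite divff // pnatr_eq0 -lt0n expn_gt0.
rewrite /hits (eq_bigr (fun=> 1%N)); first by rewrite sum_nat_const muln1 card_ffun !card_ord.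
by move=> v _; rewrite asboolT // andbT; case: forallP => // H; case: H.
Qed.

Definition cmu (B : set (cylinder_type R S)) : \bar R := (lfreq B)%:E.

Lemma cmu_ge0 B : (0 <= cmu B)%E. Proof. by rewrite lee_fin lfreq_ge0. Qed.

Lemma cmu_additive : measure_function.semi_additive cmu.
Proof.
apply/additive2P; first by rewrite /cmu lfreq0.
by move=> B C _ _ BC; rewrite /cmu lfreqU // EFinD.
Qed.

HB.instance Definition _ := isContent.Build _ _ R cmu cmu_ge0 cmu_additive.

(** A cylinder is closed, hence compact, and cylinders are open: a countable cover has a finite
    subcover, and finite subadditivity suffices. *)
Lemma cmu_sigma_subadditive : measurable_subset_sigma_subadditive cmu.
Proof.
move=> B F mF mB BF.
have cB : compact (B : set X).
  apply: (subclosed_compact _ (@shift_space_compact R d A S)) => //.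
  by rewrite -(setCK B); apply/open_closedC/cylinder_open/cylinderC.
move: cB; rewrite compact_cover => /(_ nat setT F) [].
- by move=> i _; apply/cylinder_open/mF.
- by move=> x /BF.
move=> D _ BD; pose n := (\max_(i <- finmap.enum_fset D) i).+1.
apply: (@le_trans _ _ (\sum_(0 <= k < n) cmu (F k))%E); last first.
  by apply: nneseries_lim_ge => k _ _; exact: cmu_ge0.
rewrite big_mkord; apply: content_subadditive => // x /BD[i /= iD Fix].
rewrite -bigcup_mkord; exists i => //=.
by rewrite ltnS; apply: (@leq_bigmax_seq _ _ xpredT id).
Qed.


HB.instance Definition _ :=
  Content_SigmaSubAdditive_isMeasure.Build _ R _ cmu cmu_sigma_subadditive.

Definition bmu : set (borel X) -> \bar R := measure_extension cmu.

Lemma bmu_cylinder B : cylinder B -> bmu B = (lfreq B)%:E.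
Proof. by move=> cB; rewrite /bmu /measure_extension measurable_mu_extE. Qed.

Lemma bmu_sigma_additive : semi_sigma_additive bmu.
Proof.
move=> F mF tF mUF; apply: (@measure_semi_sigma_additive _ _ _ (measure_extension cmu)) => //.
- by move=> i; have := mF i; rewrite borel_cylinder.
- by rewrite borel_cylinder in mUF.
Qed.

Lemma bmu0 : bmu set0 = 0%E.
Proof. by rewrite bmu_cylinder ?lfreq0 //; exact: cylinder0. Qed.

Lemma bmu_ge0 B : (0 <= bmu B)%E. Proof. exact: measure_ge0. Qed.

HB.instance Definition _ := isMeasure.Build _ (borel X) R bmu bmu0 bmu_ge0 bmu_sigma_additive.

Lemma bmuT : bmu setT = 1%E.
Proof. by rewrite bmu_cylinder ?lfreqT // -setC0; apply/cylinderC/cylinder0. Qed.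

HB.instance Definition _ := Measure_isProbability.Build _ (borel X) R bmu bmuT.

End LimitFrequency.

(** * Lattices inside subgroups of finite index *)

Lemma nat_collision (T : Type) (f : nat -> T) : finite_set (range f) ->
  exists q n, (0 < q)%N /\ f n = f (n + q)%N.
Proof.
move=> Ff; apply: contrapT => H; apply: infinite_nat.
have finj : injective f.
  move=> m n mn; apply: contrapT => /eqP; rewrite neq_ltn => /orP[lt|lt]; apply: H.
    by exists (n - m)%N, m; split; [rewrite subn_gt0|rewrite subnKC // ltnW].
  by exists (m - n)%N, n; split; [rewrite subn_gt0|rewrite subnKC // ltnW].
rewrite (_ : setT = f @^-1` (range f)); last by apply/seteqP; split => // m _ /=; exists m.
by apply: finite_preimage => // m n _ _; exact: finj.
Qed.

Section FiniteIndex.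
Variables (G : zmodType) (F : set G).
Hypotheses (FS : is_subgroup F) (Ffin : finite_index F).

Lemma subgroupN g : F g -> F (- g).
Proof. by case: FS => F0 FB Fg; rewrite -sub0r; exact: FB. Qed.

Lemma subgroupD g h : F g -> F h -> F (g + h).
Proof. by case: FS => F0 FB Fg Fh; rewrite -(opprK h); apply/FB/subgroupN. Qed.

Lemma subgroupMn g n : F g -> F (g *+ n).
Proof.
by move=> Fg; elim: n => [|n IH]; [case: FS|rewrite mulrS; exact: subgroupD].
Qed.

Lemma finite_index_mulrn g : exists2 q, (0 < q)%N & F (g *+ q).
Proof.
pose f n := [set h | F (h - g *+ n)].
have [|q [n [nq E]]] := @nat_collision _ f.
  by apply: sub_finite_set Ffin => _ [m _ <-]; exists (g *+ m).
exists q => //; have : f (n + q)%N (g *+ (n + q)).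
  by rewrite /f /= subrr; case: FS.
by rewrite -E /f /= mulrnDr addrC addKr.
Qed.

End FiniteIndex.

(** Each basis vector has a positive multiple in [F], as two of its multiples share a coset; [q] is
    the product of these multipliers. *)
Lemma finite_index_lattice d (F : set 'rV[int]_d) : is_subgroup F -> finite_index F ->
  exists2 q, (0 < q)%N & forall v : 'I_d -> nat, (forall i, q %| v i)%N -> F (toZ v).
Proof.
move=> FS Ff.
have H i : exists q, (0 < q)%N /\ F ((delta_mx 0 i : 'rV[int]_d) *+ q).
  by have [q q0 Fq] := finite_index_mulrn FS Ff (delta_mx 0 i); exists q.
have [q Hq] := choice H; exists (\prod_i q i)%N.
  by rewrite prodn_gt0 // => i; have [] := Hq i.
move=> v qv; have -> : toZ v = \sum_i (delta_mx 0 i : 'rV[int]_d) *+ v i.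
  apply/rowP => i; rewrite mxE summxE (bigD1 i) //= mulmxnE mxE !eqxx big1 ?addr0 ?natz //.
  by move=> j ji; rewrite mulmxnE mxE eqxx eq_sym (negPf ji) mul0rn.
apply: big_ind => [|g h|i _]; [by case: FS|exact: subgroupD|].
have /dvdnP[c ->] : (q i %| v i)%N.
  by apply: dvdn_trans (qv i); rewrite (bigD1 i) //= dvdn_mulr.
by rewrite mulnC mulrnA; apply: subgroupMn => //; have [] := Hq i.
Qed.


(** * Strict ergodicity from uniform frequencies and recurrence *)

Section Invariance.
Variables (R : realType) (d : nat) (A : finType) (S : subshift d A).
Local Notation X := (shift_space R S).

Hypothesis equidistributed : forall (B : set X) q T, cylinder B -> (0 < q)%N -> (0 < T)%N ->
  exists L0, forall L (x y : X), (L0 <= L)%N ->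
    (T * hits q B x L <= T * hits q B y L + L ^ d)%N.

Lemma saction_comm g h (x : X) : saction g (saction h x) = saction h (saction g x).
Proof.
by have [_ TD _] := @saction_action R d A S; have := TD g h; have := TD h g;
  rewrite addrC => -> /(congr1 (@^~ x)).
Qed.

Lemma hits_shift q B g (x : X) L : hits q (saction g @^-1` B) x L = hits q B (saction g x) L.
Proof. by apply: eq_bigr => v _; rewrite /preimage /= saction_comm. Qed.

Section Limit.
Variables (x0 : X) (U : set_system nat).
Hypotheses (UU : UltraFilter U) (Uoo : \oo `<=` U).

(** The frequency of the preimage of [B] at [x0] is the frequency of [B] at the translate of [x0],
    and by equidistribution with [q = 1] the two points have asymptotically equal frequencies. *)
Lemma lfreq_invariant B g : cylinder B -> lfreq x0 U (saction g @^-1` B) = lfreq x0 U B.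
Proof.
move=> cB; apply/eqP; rewrite -subr_eq0 -normr_le0; apply/ler_addgt0Pl => e e0.
rewrite addr0.
have cv : (fun L => `|freq (saction g @^-1` B) x0 L - freq B x0 L|) @ U -->
    `|lfreq x0 U (saction g @^-1` B) - lfreq x0 U B|.
  by apply: cvg_norm; apply: cvgB; exact: lfreq_cvg.
apply: (cvgr_to_le cv).
have [T T0 Te] : exists2 T, (0 < T)%N & T%:R^-1 < e.
  exists (Num.trunc e^-1).+1 => //.
  by rewrite invf_plt ?posrE ?ltr0n // truncnS_gt.
have [L0 HL] := @equidistributed B 1 T cB isT T0.
apply: Uoo; exists L0 => // L /= L0L.
rewrite /freq hits_shift -mulrBl normrM [`|(_ ^-1)|]ger0_norm ?invr_ge0 ?ler0n //.
have LD : (0 : R) < (L.+1 ^ d)%:R by rewrite ltr0n expn_gt0.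
rewrite ler_pdivrMr //; apply: (@le_trans _ _ (T%:R^-1 * (L.+1 ^ d)%:R)); last first.
  by rewrite ler_pM2r // ltW.
rewrite ler_pdivlMl ?ltr0n //.
have H1 := HL L.+1 x0 (saction g x0) (leqW L0L).
have H2 := HL L.+1 (saction g x0) x0 (leqW L0L).
rewrite -(ler_nat R) natrD !natrM in H1; rewrite -(ler_nat R) natrD !natrM in H2.
have T0' : (0 : R) < T%:R by rewrite ltr0n.
rewrite -[T%:R in leLHS]ger0_norm ?ler0n // -normrM ler_norml mulrBr.
by rewrite natrX in LD *; rewrite !natrX in H1 H2; lra.
Qed.

Section Shifted.
Variable g : 'rV[int]_d.
Definition shifted_bmu (B : set (borel X)) : \bar R := bmu x0 UU (saction g @^-1` B).

Lemma saction_measurable (B : set (borel X)) : measurable B ->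
  measurable (saction g @^-1` B : set (borel X)).
Proof.
have mg : measurable_fun [set: borel X] (saction g : borel X -> borel X).
  apply: (@measurability _ _ (borel X) (borel X) setT (saction g) (@open X)) => // _ [V oV <-].
  rewrite setTI; apply: sub_sigma_algebra.
  apply: open_comp => // x _; have [_ _ H] := @saction_action R d A S; exact: H.
by move=> mB; rewrite -[X in measurable X]setTI; exact: mg.
Qed.

Lemma shifted_bmu0 : shifted_bmu set0 = 0%E.
Proof. by rewrite /shifted_bmu preimage_set0 measure0. Qed.

Lemma shifted_bmu_ge0 B : (0 <= shifted_bmu B)%E.
Proof. exact: measure_ge0. Qed.

Lemma shifted_bmu_sigma_additive : semi_sigma_additive shifted_bmu.
Proof.
move=> E mE tE mUE; rewrite /shifted_bmu preimage_bigcup.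
apply: measure_semi_sigma_additive.
- by move=> n; exact: saction_measurable.
- apply/trivIsetP => /= i j _ _ ij; rewrite -preimage_setI.
  by move/trivIsetP : tE => /(_ _ _ _ _ ij) ->//; rewrite preimage_set0.
- by rewrite -preimage_bigcup; exact: saction_measurable.
Qed.

HB.instance Definition _ := isMeasure.Build _ (borel X) R shifted_bmu
  shifted_bmu0 shifted_bmu_ge0 shifted_bmu_sigma_additive.

Lemma shifted_bmuT : shifted_bmu setT = 1%E.
Proof. by rewrite /shifted_bmu preimage_setT bmuT. Qed.

HB.instance Definition _ := Measure_isProbability.Build _ (borel X) R shifted_bmu shifted_bmuT.

Lemma bmu_invariant (B : set (borel X)) : measurable B ->
  bmu x0 UU (saction g @^-1` B) = bmu x0 UU B.
Proof.
move=> mB; apply: (@cylinder_measure_unique R d A S shifted_bmu (bmu x0 UU)) => // C cC.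
change (bmu x0 UU (saction g @^-1` C) = bmu x0 UU C).
by rewrite !bmu_cylinder ?lfreq_invariant //; exact: cylinder_preimage.
Qed.

End Shifted.
End Limit.

Lemma invariant_probability : exists mu : probability (borel X) R,
  invariant_measure (@saction R d A S) setT mu.
Proof.
have [U [UU Uoo]] := ultraFilterLemma (eventually_filter).
exists (bmu point UU) => g _ B mB; exact: bmu_invariant.
Qed.


Section Uniqueness.
Variables (F : set 'rV[int]_d) (q : nat).
Hypotheses (q0 : (0 < q)%N) (Fq : forall v : 'I_d -> nat, (forall i, q %| v i)%N -> F (toZ v)).

(** By invariance each visited position contributes [mu B]; a box of side [q * L] has exactly [L]
    multiples of [q] in each direction. *)
Lemma hits_integral (mu : probability (borel X) R) B L : cylinder B ->
  invariant_measure (@saction R d A S) F mu ->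
  (\int[mu]_x ((hits q B x (q * L))%:R : R)%:E = ((L ^ d)%:R)%:E * mu B)%E.
Proof.
move=> cB muI.
pose P (v : {ffun 'I_d -> 'I_(q * L)}) := [forall i, q %| v i]%N.
pose G v : set (borel X) := if P v then saction (toZ (fun i => v i)) @^-1` B else set0.
have mG v : measurable (G v).
  rewrite /G; case: (P v); last exact: measurable0.
  by apply: cylinder_measurable; apply: cylinder_preimage.
transitivity (\int[mu]_x (\sum_(v <- index_enum {ffun 'I_d -> 'I_(q * L)}) (\1_(G v) x : R)%:E))%E.
  apply: eq_integral => x _; rewrite /hits natr_sum sumEFin; congr EFin; apply: eq_bigr => v _.
  rewrite indicE /G -/(P v); case: (P v) => /=; last by rewrite in_set0.
  by congr (nat_of_bool _)%:R; apply/asboolP/idP; rewrite inE.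
rewrite ge0_integral_sum //; last first.
  by move=> v; apply/measurable_EFinP; exact: measurable_indic.
transitivity (\sum_(v : {ffun 'I_d -> 'I_(q * L)}) ((P v)%:R : R)%:E * mu B)%E.
  apply: eq_bigr => v _; rewrite integral_indic // setIT /G.
  case: ifP => [/forallP Pv|_]; last by rewrite measure0 mul0e.
  rewrite mul1e; apply: muI; [exact: Fq|exact: cylinder_measurable].
rewrite -ge0_sume_distrl; last by move=> v _; rewrite lee_fin.
rewrite sumEFin -natr_sum; congr (_%:R%:E * _)%E.
rewrite (sum_ffun_forall (fun _ (j : 'I_(q * L)) => q %| j)%N) prod_nat_const card_ord.
congr expn; have := @sum_dvdn_lin q (q * L) 0 1 q0 (dvdn_mulr _ (dvdnn q)) (coprimen1 q).
rewrite mulKn // => LE; rewrite -[RHS]LE.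
by apply: eq_bigr => r _; rewrite muln1 add0n.
Qed.

Lemma hits_measurable B L : cylinder B ->
  measurable_fun [set: borel X] (fun x : X => ((hits q B x L)%:R : R)%:E).
Proof.
move=> cB; apply/measurable_EFinP.
rewrite (_ : (fun _ => _) = fun x => \sum_(v : {ffun 'I_d -> 'I_L})
   (([forall i, q %| v i]%N)%:R * \1_(saction (toZ (fun i => v i)) @^-1` B) x)); last first.
  apply/funext => x; rewrite natr_sum; apply: eq_bigr => v _.
  rewrite indicE -natrM mulnb; congr (nat_of_bool (_ && _))%:R.
apply: measurable_sum => v; apply: measurable_funM => //.
by apply: measurable_indic; apply: cylinder_measurable; apply: cylinder_preimage.
Qed.

(** The hypothesis compares every point with the reference point [point]; integrating it in both
    directions replaces the count by its mean, which [hits_integral] computes. *)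
Lemma invariant_cylinder_bounds (mu : probability (borel X) R) B T L : cylinder B ->
  invariant_measure (@saction R d A S) F mu ->
  (forall x y : X, (T * hits q B x (q * L) <= T * hits q B y (q * L) + (q * L) ^ d)%N) ->
  `|T%:R * ((L ^ d)%:R * fine (mu B)) - T%:R * (hits q B point (q * L))%:R| <= ((q * L) ^ d)%:R :> R.
Proof.
move=> cB muI H; set h := (hits q B point _)%:R.
have muB : mu B = (fine (mu B))%:E.
  by rewrite fineK // fin_num_measure //; exact: cylinder_measurable.
have E := hits_integral L cB muI; rewrite muB -EFinM in E.
have cst (c : R) : (\int[mu]_x (c%:E) = c%:E)%E.
  rewrite integral_cst //; transitivity (c%:E * 1)%E; last by rewrite mule1.
  congr mule; exact: probability_setT.
have mh := hits_measurable (q * L) cB.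
have le1 : (\int[mu]_x ((T%:R * h)%:E) <=
    \int[mu]_x ((T%:R%:E * (hits q B x (q * L))%:R%:E + (((q * L) ^ d)%:R)%:E)))%E.
  apply: ge0_le_integral => //.
  - by move=> x _; rewrite lee_fin mulr_ge0 ?ler0n.
  - by apply: emeasurable_funD => //; apply: emeasurable_funM.
  - by move=> x _; rewrite -EFinM -EFinD lee_fin -!natrM -natrD ler_nat.
have le2 : (\int[mu]_x (T%:R%:E * (hits q B x (q * L))%:R%:E) <=
    \int[mu]_x (T%:R * h + ((q * L) ^ d)%:R)%:E)%E.
  apply: ge0_le_integral => //.
  - by apply: emeasurable_funM.
  - by move=> x _; rewrite -EFinM lee_fin -!natrM -natrD ler_nat.
have TE : (\int[mu]_x (T%:R%:E * (hits q B x (q * L))%:R%:E) =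
    (T%:R * ((L ^ d)%:R * fine (mu B)))%:E)%E.
  by rewrite ge0_integralZl_EFin ?ler0n // ?E // => x _; rewrite lee_fin ler0n.
have IE : (\int[mu]_x ((T%:R%:E * (hits q B x (q * L))%:R%:E + (((q * L) ^ d)%:R)%:E)) =
    (T%:R * ((L ^ d)%:R * fine (mu B)) + ((q * L) ^ d)%:R)%:E)%E.
  by rewrite ge0_integralD // ?TE ?cst //; apply: emeasurable_funM.
rewrite IE cst lee_fin in le1.
rewrite TE cst lee_fin in le2.
by rewrite ler_norml; apply/andP; split; lra.
Qed.

Lemma uniquely_ergodic_lattice (mu : probability (borel X) R) :
  invariant_measure (@saction R d A S) F mu -> uniquely_ergodic (@saction R d A S) F.
Proof.
move=> muI; exists mu => // nu nuI; apply: cylinder_measure_unique => B cB.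
have fin (m : probability (borel X) R) : m B \is a fin_num.
  by rewrite fin_num_measure //; exact: cylinder_measurable.
rewrite -(fineK (fin mu)) -(fineK (fin nu)); congr EFin.
apply/eqP; rewrite -subr_eq0 -normr_le0; apply/ler_addgt0Pl => e e0; rewrite addr0.
(* Both measures are compared with the count at the same point, hence the 2; the box has side
   [q * L] but only [L ^ d] counted positions, hence [q ^ d]. *)
have [T T0 Te] : exists2 T, (0 < T)%N & T%:R^-1 < e / (2 * (q ^ d)%:R).
  have : 0 < e / (2 * (q ^ d)%:R) by rewrite divr_gt0 // mulr_gt0 // ltr0n expn_gt0 q0.
  move: (e / _) => e' e'0; exists (Num.trunc e'^-1).+1 => //.
  by rewrite invf_plt ?posrE ?ltr0n // truncnS_gt.
have [L0 HL] := equidistributed cB q0 T0.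
pose L := L0.+1.
have HL' x y := HL (q * L)%N x y (leq_trans (leqnSn _) (leq_pmull _ q0)).
have Bm := invariant_cylinder_bounds cB muI HL'.
have Bn := invariant_cylinder_bounds cB nuI HL'.
have T0' : (0 : R) < T%:R by rewrite ltr0n.
have LD : (0 : R) < (L ^ d)%:R by rewrite ltr0n expn_gt0.
have qD : (0 : R) < (q ^ d)%:R by rewrite ltr0n expn_gt0 q0.
rewrite expnMn natrM in Bm Bn.
have : T%:R * (L ^ d)%:R * `|fine (nu B) - fine (mu B)| <= 2 * ((q ^ d)%:R * (L ^ d)%:R).
  rewrite -[T%:R * _ in leLHS]ger0_norm ?mulr_ge0 ?ler0n // -normrM mulrBr.
  rewrite -!mulrA; move: Bm Bn; rewrite !ler_norml => /andP[b1 b2] /andP[b3 b4].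
  by apply/andP; split; lra.
rewrite mulrAC mulrA ler_pM2r // -ler_pdivlMl // => /le_trans; apply.
rewrite -ler_pdivlMr ?mulr_gt0 //; exact: ltW.
Qed.

End Uniqueness.

Hypothesis recurrent : forall q n (x y : X), (0 < q)%N ->
  exists2 v : 'I_d -> nat, (forall i, q %| v i)%N & agree n (sval (saction (toZ v) x)) (sval y).

Lemma saction_totally_strictly_ergodic : totally_strictly_ergodic (@saction R d A S).
Proof.
move=> F FS Ff; have [q q0 Fq] := finite_index_lattice FS Ff; split.
  move=> x O [y Oy] oO; move: (oO); rewrite openE => /(_ y Oy)/nbhs_agree[n On].
  have [v qv vy] := recurrent n x y q0.
  exists (saction (toZ v) x); split; last by exists (toZ v) => //; exact: Fq.
  by apply: On; rewrite agree_sym.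
have [mu muI] := invariant_probability.
by apply: (uniquely_ergodic_lattice q0 Fq (mu := mu)) => g _; exact: muI.
Qed.

End Invariance.

(** * The block subshift *)

Section BlockSubshift.
Variables (D : nat) (A : finType) (a0 : A).
Hypothesis A_large : (3 < #|A|)%N.
Local Notation vec := ('I_D.+1 -> nat).
Local Notation side := (side D a0).
Local Notation block_shift := (block_shift (D := D) a0).

Lemma side_ge k : (k <= side k)%N.
Proof.
by elim: k => // k IH; apply: leq_ltn_trans IH (side_mono D a0 A_large k).
Qed.

(** Blocks of growing level are centred at the origin, and an ultrafilter limit is taken at each
    site. A finite window of the limit is a window of one centred block. *)
Lemma block_shift_exists : exists x, block_shift x.
Proof.
have [U [UU Uoo]] := ultraFilterLemma eventually_filter.
pose c k : lab D a0 k := base_label (level D a0 k).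
pose y k (g : 'rV[int]_D.+1) : A := cont (c k) (fun i => absz (g ord0 i + (side k)./2%:Z)).
have [x Hx] := choice (fun g => ultra_finite (fun k => y k g) UU).
(* From level [m] on, the window lies inside the centred block, where [absz] acts on nonnegative
   numbers only. *)
exists x => b L; pose m := ((radius b + L).+1.*2)%N.
have HU : \forall k \near U, forall v : {ffun 'I_D.+1 -> 'I_L},
    y k (b + toZ (fun i => v i)) = x (b + toZ (fun i => v i)).
  apply: (@filter_forall nat _ (fun v : {ffun 'I_D.+1 -> 'I_L} =>
    [set k | y k (b + toZ (fun i => v i)) = x (b + toZ (fun i => v i))]) U) => v.
  exact: Hx.
have [k [kE mk]] : exists k, (forall v : {ffun 'I_D.+1 -> 'I_L},
    y k (b + toZ (fun i => v i)) = x (b + toZ (fun i => v i))) /\ (m <= k)%N.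
  by apply: (@filter_ex _ U); apply: filterI HU _; apply: Uoo; exists m.
have sk : (m <= side k)%N := leq_trans mk (side_ge k).
have hb i : (`|b ord0 i|%N <= radius b)%N := radius_ge b i.
exists k, (c k), (fun i => absz (b ord0 i + (side k)./2%:Z)); split.
  move=> i; have := hb i; have := odd_double_half (side k).
  by move: sk; rewrite /m -!addnn; move: (b ord0 i) (side k) (radius b) => z s r; lia.
move=> v vL; pose w : {ffun 'I_D.+1 -> 'I_L} := [ffun i => Ordinal (vL i)].
have -> : toZ v = toZ (fun i => w i) by congr toZ; apply/funext => i; rewrite ffunE.
rewrite -kE /y; congr (cont _ _); apply/funext => i; rewrite !mxE ffunE /=.
have := hb i; have := odd_double_half (side k).
by move: sk; rewrite /m -!addnn; move: (b ord0 i) (side k) (radius b) => z s r; lia.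
Qed.

Lemma block_shift_agree x :
  (forall n, exists2 y, block_shift y & agree n x y) -> block_shift x.
Proof.
move=> H; apply: block_shift_closed => b L; have [y yS /agreeP xy] := H (radius b + L)%N.
exists y => // v vL; apply: xy => i; have := radius_ge b i; rewrite !mxE; have := vL i.
by move: (b ord0 i) (v i) => z w; lia.
Qed.

Definition block_subshift : subshift D.+1 A :=
  Subshift (svalP (cid block_shift_exists)) (fun g x H => block_shift_translate g H)
    block_shift_agree.

Variable R : realType.
Local Notation X := (shift_space R block_subshift).
Local Notation corner n := (toZ (fun _ : 'I_D.+1 => n)).

Lemma agree_corner n (x y : 'rV[int]_D.+1 -> A) : (forall v : vec, (forall i, v i <= n.*2)%N ->
  x (- corner n + toZ v) = y (- corner n + toZ v)) -> agree n x y.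
Proof.
move=> H; apply/agreeP => g gn; pose v i := absz (g ord0 i + n%:Z).
have -> : g = - corner n + toZ v.
  apply/rowP => i; rewrite !mxE /v; have := gn i.
  by rewrite (_ : 0 = ord0) //; move: (g ord0 i) => z; lia.
apply: H => i; rewrite /v; have := gn i; rewrite -addnn.
by move: (g ord0 i) => z; lia.
Qed.

Lemma block_equidistributed (B : set X) q T : cylinder B -> (0 < q)%N -> (0 < T)%N ->
  exists L0, forall L (x y : X), (L0 <= L)%N ->
    (T * hits q B x L <= T * hits q B y L + L ^ D.+1)%N.
Proof.
move=> [n Bn] q0 T0.
(* Locality is required for all functions [w], also those that come from no point of the subshift;
   hence the existential form. *)
pose phi (w : vec -> A) : bool := `[< exists2 y : X, B y &
  forall h : vec, (forall i, h i <= n.*2)%N -> w h = sval y (- corner n + toZ h) >].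
have phiL g g' : (forall h, (forall i, h i <= n.*2)%N -> g h = g' h) -> phi g = phi g'.
  move=> gg'; apply/asboolP/asboolP => -[y By H]; exists y => // h hn.
    by rewrite -gg' // H.
  by rewrite gg' // H.
have [L0 HL] := uniform_visits a0 A_large q0 T0 phiL.
have E (x : X) L :
    hits q B x L = visits q phi (fun v => sval (saction (- corner n) x) (toZ v)) L.
  apply: eq_bigr => v _; congr (nat_of_bool (_ && _)).
  apply/asboolP/asboolP => [Bx|[y By H]].
    exists (saction (toZ (fun i => v i)) x) => // h hn /=; congr (sval x _).
    by rewrite toZD addrCA.
  apply: Bn By; apply: agree_corner => h hn.
  by rewrite -H //=; congr (sval x _); rewrite toZD addrCA.
exists L0 => L x y L0L; rewrite !E; apply: HL => //; exact: svalP.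
Qed.

Lemma block_recurrent q n (x y : X) : (0 < q)%N ->
  exists2 v : vec, (forall i, q %| v i)%N & agree n (sval (saction (toZ v) x)) (sval y).
Proof.
move=> q0.
have [s qs H] := pattern_recurs A_large (- corner n) n.*2.+1 q0
  (svalP (saction (- corner n) x)) (svalP y).
exists s => //; apply: agree_corner => v vn.
rewrite -H; last by move=> i; rewrite ltnS.
by rewrite /=; congr (sval x _); rewrite toZD addrCA.
Qed.

End BlockSubshift.

(** * Entropy *)

(** By convexity the power lies below its chord on [[0, 1]], which is the stronger bound proved by
    induction. *)
Lemma expr1D_le (R : realFieldType) (d : nat) (y : R) : 0 <= y <= 1 ->
  (1 + y) ^+ d <= 1 + 2 ^+ d * y.
Proof.
move=> /andP[y0 y1]; suff : (1 + y) ^+ d <= 1 + (2 ^+ d - 1) * y by lra.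
elim: d => [|d IH]; first by rewrite !expr0 subrr mul0r addr0.
rewrite !exprS; apply: (@le_trans _ _ ((1 + y) * (1 + (2 ^+ d - 1) * y))).
  by rewrite ler_wpM2l // addr_ge0.
have : 0 <= (2 ^+ d - 1) * (y * (1 - y)).
  by rewrite !mulr_ge0 // subr_ge0 // exprn_ege1 // ler1n.
lra.
Qed.

(** * Convergence of almost subadditive rates *)

Section Fekete.
Variables (R : realType) (d : nat) (a : nat -> R).
Hypothesis a_ge0 : forall n, 0 <= a n.
Hypothesis a_sub : forall n N : nat, (0 < n)%N -> (0 < N)%N ->
  a N <= (1 + n%:R / N%:R) ^+ d * a n.

(** Letting [N] grow in [a_sub] bounds the upper limit by each [a n], so the sequence tends to its
    infimum. A bound reached infinitely often then passes to the limit. *)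
Lemma fekete_cvg (M : R) : (forall N, exists2 n, (N <= n)%N & M <= a n) ->
  cvgn a /\ M <= limn a.
Proof.
move=> aM.
pose E := [set a n | n in [set n | (0 < n)%N]].
have Einf : has_inf E.
  by split; [exists (a 1%N), 1%N|exists 0 => _ [n _ <-]].
have cv : a @ \oo --> inf E.
  apply/cvgrPdist_le => e e0; have e2 : 0 < e / 2 by rewrite divr_gt0.
  have [_ [n n0 <-] an] := inf_adherent e2 Einf.
  pose c := 2 ^+ d * n%:R * a n.
  have c0 : 0 <= c by rewrite !mulr_ge0 // exprn_ge0.
  exists (n + (Num.trunc (c / (e / 2))).+1)%N => // N /= nN.
  have N0 : (0 < N)%N by apply: leq_trans nN; rewrite addnS.
  have N0' : (0 : R) < N%:R by rewrite ltr0n.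
  have lo : inf E <= a N by apply: ge_inf; [exact: (proj2 Einf)|exists N].
  have hi : a N <= a n + c / N%:R.
    apply: (le_trans (a_sub n0 N0)).
    have y01 : 0 <= (n%:R / N%:R : R) <= 1.
      rewrite divr_ge0 ?ler0n //= ler_pdivrMr // mul1r ler_nat.
      exact: leq_trans (leq_addr _ _) nN.
    apply: (le_trans (ler_wpM2r (a_ge0 n) (expr1D_le d y01))).
    by rewrite /c mulrDl mul1r lerD2l le_eqVlt; apply/orP; left; apply/eqP; ring.
  have cN : c / N%:R <= e / 2.
    rewrite ler_pdivrMr // mulrC -ler_pdivrMr //; apply/ltW.
    apply: lt_le_trans (truncnS_gt _) _; rewrite ler_nat.
    exact: leq_trans (leq_addl _ _) nN.
  rewrite ler_norml; apply/andP; split; lra.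
have cva := cvgP _ cv; split => //; rewrite (cvg_lim _ cv) //.
rewrite leNgt; apply/negP => lt.
have e0 : 0 < M - inf E by rewrite subr_gt0.
move/cvgrPdist_lt : cv => /(_ _ e0)[N _ HN].
have [n Nn Mn] := aM N; have := HN n Nn; rewrite ltr_norml => /andP[]; lra.
Qed.
End Fekete.

(** * Topological entropy bounded below by pattern counts *)

Section Entropy.
Variables (R : realType) (d : nat) (A : finType) (S : subshift d A).
Local Notation X := (shift_space R S).
Local Notation cube n := {ffun 'I_d -> 'I_n}.
Local Notation act := (@saction R d A S).

Definition pattern n (x : X) : {ffun cube n -> A} :=
  [ffun f => sval x (toZ (fun i => (f : cube n) i))].

Definition patterns n : {set {ffun cube n -> A}} :=
  [set w | `[< exists x, pattern n x = w >]].

Lemma mem_pattern n x : pattern n x \in patterns n.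
Proof. by rewrite inE; apply/asboolP; exists x. Qed.

Lemma patterns_gt0 n : (0 < #|patterns n|)%N.
Proof. by apply/card_gt0P; exists (pattern n point); exact: mem_pattern. Qed.

(** The supremum defining the entropy is bounded below through this one cover, whose iterated joins
    separate exactly the patterns on boxes. *)
Definition symbol_cover : set (set X) := [set [set x | sval x 0 = a] | a in [set: A]].

Lemma symbol_open_cover : open_cover symbol_cover.
Proof.
split.
  move=> _ [a _ <-]; apply: (@cylinder_open R d A S); exists 0%N => x y /agreeP xy /= <-.
  by rewrite xy // => i; rewrite mxE.
apply/seteqP; split=> // x _; exists [set y : X | sval y 0 = sval x 0] => //.
by exists (sval x 0).
Qed.

Lemma toZ_inj n : injective (fun f : cube n => toZ (fun i => f i)).
Proof.
by move=> f g /rowP fg; apply/ffunP => i; apply: val_inj; have := fg i; rewrite !mxE => -[].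
Qed.

Lemma box_toZ n g : box n g -> exists f : cube n, g = toZ (fun i => f i).
Proof.
move=> gn; have Hn i : (absz (g ord0 i) < n)%N by have := gn i; move: (g ord0 i) => z; lia.
exists [ffun i => Ordinal (Hn i)]; apply/rowP => i; rewrite mxE ffunE /=.
by rewrite (_ : 0 = ord0) //; have := gn i; move: (g ord0 i) => z; lia.
Qed.

Lemma toZ_box n (f : cube n) : box n (toZ (fun i => f i)).
Proof. by move=> i; rewrite mxE; have := ltn_ord (f i); lia. Qed.

Lemma join_pattern n B (x y : X) : iterated_join act symbol_cover n B -> B x -> B y ->
  pattern n x = pattern n y.
Proof.
move=> [C CU <-] Bx By; apply/ffunP => f; rewrite !ffunE.
have fb := toZ_box f; have [a _ Ca] := CU _ fb.
have := Bx _ fb; have := By _ fb; rewrite -Ca /= !addr0 => -> -> //.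
Qed.

Lemma pattern_join n w : iterated_join act symbol_cover n [set x | pattern n x = w].
Proof.
(* For [g] in the box exactly one [f] satisfies the equation, by [toZ_inj], so [sym g] belongs to
   the cover. *)
pose sym g := [set x : X | forall f : cube n, g = toZ (fun i => f i) -> sval x 0 = w f].
exists sym.
  move=> g /box_toZ[f ->]; exists (w f) => //; apply/seteqP; split=> x /=.
    by move=> xw f' /toZ_inj <-.
  by apply.
apply/seteqP; split=> x /=.
  move=> H; apply/ffunP => f; rewrite ffunE; have := H _ (toZ_box f) f erefl.
  by rewrite /= addr0.
by move=> xw g gb f ->; rewrite /= addr0 -xw ffunE.
Qed.

(** All points of a member of the join have the same pattern, so a subcover needs a separate member
    for each occurring pattern, and these suffice. *)
Lemma cover_number_patterns n :
  cover_number R (iterated_join act symbol_cover n) = (#|patterns n|)%:R.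
Proof.
rewrite /cover_number; set E := (X in inf X).
have lb k : [set k : nat | exists V : set (set X),
    [/\ V `<=` iterated_join act symbol_cover n, (V #= `I_k)%card & cover V id = [set: X]]] k ->
    (#|patterns n| <= k)%N.
  move=> [V [VJ Vk Vc]].
  have Hx (w : {ffun cube n -> A}) : exists B : set X, w \in patterns n ->
      V B /\ exists2 x, B x & pattern n x = w.
    have [|_] := boolP (w \in patterns n); last by exists setT.
    rewrite inE => /asboolP[x xw]; have : cover V id x by rewrite Vc.
    by move=> [B VB Bx]; exists B => _; split => //; exists x.
  have [b Hb] := choice Hx.
  have [e [eV einj]] : exists e : set X -> nat,
      (forall B, V B -> (e B < k)%N) /\ {in V &, injective e}.
    by move/card_set_bijP : Vk => [e [e1 e2 _]]; exists e; split.
  case: k Vk eV => [|k] Vk eV.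
    have [w wP] : exists w, w \in patterns n by exists (pattern n point); exact: mem_pattern.
    by have [Vb _] := Hb w wP; have := eV _ Vb.
  rewrite -[k.+1]card_ord.
  rewrite -(card_in_image (f := fun w => inord (e (b w)) : 'I_k.+1) (A := patterns n)).
    exact: max_card.
  move=> w w' wP wP' /(congr1 val) /=.
  have [Vb [x bx xw]] := Hb w wP; have [Vb' [x' bx' xw']] := Hb w' wP'.
  rewrite !inordK ?eV // => /einj; rewrite !inE => /(_ Vb Vb') bb.
  by rewrite -xw -xw'; apply: join_pattern (VJ _ Vb) bx _; rewrite bb.
have mem : E (#|patterns n|)%:R.
  pose w0 := pattern n point; pose f k := [set x | pattern n x = nth w0 (enum (patterns n)) k].
  exists #|patterns n| => //; exists [set f k | k in `I_#|patterns n|]; split.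
  - by move=> _ [k _ <-]; exact: pattern_join.
  - apply: inj_card_eq => k l; rewrite !inE /= => kp lp kl.
    have : nth w0 (enum (patterns n)) k \in patterns n by rewrite -mem_enum mem_nth // -cardE.
    rewrite inE => /asboolP[x xk]; have : f l x by rewrite -kl.
    rewrite /f /= xk => /eqP; rewrite nth_uniq -?cardE ?enum_uniq //.
    by move=> /eqP.
  - apply/seteqP; split=> // x _; have xp := mem_pattern n x.
    exists (f (index (pattern n x) (enum (patterns n)))); last first.
      by rewrite /f /= nth_index // mem_enum.
    by exists (index (pattern n x) (enum (patterns n))) => //=; rewrite cardE index_mem mem_enum.
apply/eqP; rewrite eq_le; apply/andP; split.
  by apply: ge_inf => //; exists 0 => _ [k _ <-].
by apply: lb_le_inf; [exists (#|patterns n|)%:R|move=> _ [k /lb lek <-]; rewrite ler_nat].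
Qed.

(** The large cube is covered by [u ^ d] translates of the small one. They may stick out, so a point
    extending each pattern is chosen first. *)
Lemma patterns_sub n u N : (0 < n)%N -> (N <= u * n)%N ->
  (#|patterns N| <= #|patterns n| ^ (u ^ d))%N.
Proof.
move=> n0 Nun.
have Hx (w : {ffun cube N -> A}) : exists x : X, w \in patterns N -> pattern N x = w.
  have [|_] := boolP (w \in patterns N); last by exists point.
  by rewrite inE => /asboolP[x xw]; exists x.
have [x Hx'] := choice Hx.
pose Phi (w : {ffun cube N -> A}) : {ffun cube u -> {ffun cube n -> A}} :=
  [ffun k : cube u => pattern n (act (toZ (fun i => k i * n)%N) (x w))].
have <- : #|cube u| = (u ^ d)%N by rewrite card_ffun !card_ord.
rewrite -card_ffun_on -(card_in_image (f := Phi) (A := patterns N)).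
  apply: subset_leq_card; apply/fintype.subsetP => v /fintype.imageP[w wP ->].
  by apply/ffun_onP => k; rewrite ffunE mem_pattern.
move=> w w' wP wP' /ffunP E.
rewrite -(Hx' w wP) -(Hx' w' wP'); apply/ffunP => f; rewrite !ffunE.
have ku i : (f i %/ n < u)%N by rewrite ltn_divLR // (leq_trans (ltn_ord _)).
have rn i : (f i %% n < n)%N by rewrite ltn_mod.
pose k : cube u := [ffun i => Ordinal (ku i)]; pose r : cube n := [ffun i => Ordinal (rn i)].
have := E k; rewrite !ffunE => /ffunP/(_ r); rewrite !ffunE /= -!toZD.
have -> : (fun i => k i * n + r i)%N = (fun i => f i : nat).
  by apply/funext => i; rewrite !ffunE /= -divn_eq.
by [].
Qed.


Definition pattern_rate n : R := ln (#|patterns n|)%:R / n%:R ^+ d.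

Lemma pattern_rate_ge0 n : 0 <= pattern_rate n.
Proof. by rewrite divr_ge0 ?exprn_ge0 // ln_ge0 // ler1n patterns_gt0. Qed.

Lemma pattern_rate_sub n N : (0 < n)%N -> (0 < N)%N ->
  pattern_rate N <= (1 + n%:R / N%:R) ^+ d * pattern_rate n.
Proof.
(* The covering overshoots by at most [n] per side, which gives the factor [1 + n / N]. *)
move=> n0 N0; pose u := (N %/ n).+1.
have n0' : (0 : R) < n%:R by rewrite ltr0n.
have N0' : (0 : R) < N%:R by rewrite ltr0n.
have Nu : (N <= u * n)%N by rewrite ltnW // ltn_ceil.
have uN : (u * n <= N + n)%N by rewrite mulSn addnC leq_add2r leq_divM.
have lp : ln (#|patterns N|)%:R <= u%:R ^+ d * ln (#|patterns n|)%:R :> R.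
  have pn : (0 : R) < (#|patterns n|)%:R by rewrite ltr0n patterns_gt0.
  rewrite -natrX mulr_natl -lnXn // -natrX ler_ln ?posrE ?ltr0n ?expn_gt0 ?patterns_gt0 //.
  by rewrite ler_nat patterns_sub.
rewrite /pattern_rate ler_pdivrMr ?exprn_gt0 //.
apply: (le_trans lp).
have H : u%:R ^+ d * n%:R ^+ d <= (1 + n%:R / N%:R) ^+ d * N%:R ^+ d :> R.
  rewrite -!exprMn lerXn2r ?nnegrE ?mulr_ge0 ?addr_ge0 ?divr_ge0 ?ler0n //.
  by rewrite mulrDl mul1r divfK ?gt_eqF // -natrM -natrD ler_nat.
set l := ln _; have l0 : 0 <= l by rewrite ln_ge0 // ler1n patterns_gt0.
have -> : (1 + n%:R / N%:R) ^+ d * (l / n%:R ^+ d) * N%:R ^+ d =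
    (1 + n%:R / N%:R) ^+ d * N%:R ^+ d * l / n%:R ^+ d :> R by ring.
by rewrite ler_pdivlMr ?exprn_gt0 // mulrAC ler_wpM2r.
Qed.

Lemma topological_entropy_ge (M : R) :
  (forall N, exists2 n, (N <= n)%N & M <= pattern_rate n) ->
  (M%:E <= topological_entropy R act)%E.
Proof.
move=> HM; have [_ le] := fekete_cvg pattern_rate_ge0 pattern_rate_sub HM.
apply: (@le_trans _ _ (limn pattern_rate)%:E); first by rewrite lee_fin.
apply: ereal_sup_ubound; exists symbol_cover; first exact: symbol_open_cover.
rewrite /cover_entropy; congr (limn _)%:E; apply/funext => n.
by rewrite cover_number_patterns.
Qed.

End Entropy.

(** The elementary Stirling bound n! >= (n / e)^n, from ln (1 + 1/n) <= 1/n. *)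
Lemma ln_fact_ge (R : realType) n : n%:R * (ln n%:R - 1) <= ln (n`!)%:R :> R.
Proof.
elim: n => [|n IH]; first by rewrite mul0r fact0 ln1.
have [->|n0] := posnP n; first by rewrite mul1r factS fact0 muln1 ln1 sub0r oppr_le0.
have n0' : (0 : R) < n%:R by rewrite ltr0n.
have n1' : (0 : R) < n.+1%:R by rewrite ltr0n.
have f0 : (0 : R) < (n`!)%:R by rewrite ltr0n fact_gt0.
rewrite factS natrM lnM ?posrE //.
have nV : 1 + n%:R^-1 = n.+1%:R / n%:R :> R.
  by rewrite -natr1 mulrDl divff ?gt_eqF // mul1r.
have : ln (1 + n%:R^-1) <= n%:R^-1 :> R.
  by apply: le_ln1Dx; rewrite (lt_trans (ltrN10 _)) // invr_gt0.
rewrite nV ln_div ?posrE // -(ler_pM2l n0') divff ?gt_eqF // mulrBr => H.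
by rewrite -natr1 in H *; lra.
Qed.

(** * Entropy of the block subshift *)

Section BlockEntropy.
Variables (R : realType) (D : nat) (A : finType) (a0 : A) (M : R).
Hypotheses (A_large : (3 < #|A|)%N) (M0 : 0 <= M).
Hypothesis A_exp : M + 4 <= ln (#|A|)%:R.
Hypothesis A_lin : 2 ^+ D.+1 * (M + 4) <= (#|A|)%:R.
Local Notation lab := (lab D a0).
Local Notation step := (step D a0).
Local Notation nsub := (nsub D a0).
Local Notation side := (side D a0).

(** The surplus [4 / 2 ^+ k] over [M] is halved at each level. One half of what is released pays for
    the 1 lost in [ln_fact_ge], the other half for the volume of the new spacers. *)
Lemma ln_lab_ge k : (M + 4 / 2 ^+ k) * (step k)%:R ^+ D.+1 <= ln (#|lab k|)%:R :> R.
Proof.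
elim: k => [|k IH]; first by rewrite expr0 divr1 (_ : step 0 = 1%N) // expr1n mulr1.
set t : R := (step k)%:R in IH; set n : R := (nsub k)%:R.
have t0 : 0 < t by rewrite ltr0n (step_gt0 D a0 A_large).
have t1 : 1 <= t by rewrite ler1n (step_gt0 D a0 A_large).
have p0 : (0 : R) < 2 ^+ k by rewrite exprn_gt0.
have t2 : 2 ^+ k <= t by rewrite -natrX ler_nat (step_ge D a0 A_large).
have n0 : 0 < n by rewrite ltr0n (nsub_gt0 D a0).
have n1 : 1 <= n by rewrite ler1n (nsub_gt0 D a0).
have nA : (#|A|)%:R <= n.
  rewrite ler_nat nsub_eq; apply: (leq_trans (card_lab D a0 k)).
  by rewrite leq_pmull // fact_gt0.
(* The exponent (k+1)! n^D in [card_labS], times [#|lab k|], is n^(D+1), because n = (k+1)!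
   [#|lab k|]. *)
have lnE : n ^+ D.+1 * (ln (#|lab k|)%:R - 1) <= ln (#|lab k.+1|)%:R.
  rewrite card_labS natrX lnXn ?ltr0n ?fact_gt0 // -[leRHS]mulr_natl.
  apply: (@le_trans _ _ (((k.+1)`! * nsub k ^ D)%:R * ((#|lab k|)%:R * (ln (#|lab k|)%:R - 1)))).
    rewrite mulrA -natrM mulnAC -nsub_eq -expnS natrX //.
  by rewrite ler_wpM2l // ln_fact_ge.
apply: le_trans lnE.
set c : R := M + 4 / 2 ^+ k.+1.
have c0 : 0 <= c by rewrite addr_ge0 // divr_ge0 // exprn_ge0.
have cM : c <= M + 4.
  rewrite lerD2l ler_pdivrMr ?exprn_gt0 // -[leLHS]mulr1 ler_wpM2l // exprn_ege1 //.
  by rewrite ler1n.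
have nt0 : 0 < n * t by rewrite mulr_gt0.
have s1 : (step k.+1)%:R ^+ D.+1 <= (n * t) ^+ D.+1 * (1 + 2 ^+ D.+1 / (n * t)) :> R.
  have le : (step k.+1)%:R <= n * t * (1 + (n * t)^-1) :> R.
    rewrite mulrDr mulr1 divff ?gt_eqF // -natrM natr1 ler_nat stepS.
    by rewrite (leq_trans (leq_subr _ _)) // -[leqRHS]addn1 leq_add2l leq_b1.
  apply: le_trans (_ : (n * t * (1 + (n * t)^-1)) ^+ D.+1 <= _).
    by rewrite lerXn2r ?nnegrE ?ler0n // mulr_ge0 ?addr_ge0 ?invr_ge0 // ltW.
  rewrite exprMn ler_wpM2l ?exprn_ge0 ?(ltW nt0) //; apply: expr1D_le.
  rewrite invr_ge0 ltW //= invf_le1 //.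
  by rewrite -[leLHS]mulr1 ler_pM.
have tD : 2 ^- k * t ^+ D.+1 >= 1.
  rewrite mulrC ler_pdivlMr // mul1r (le_trans t2) // exprS ler_peMr ?(ltW t0) //.
  by rewrite exprn_ege1.
apply: (@le_trans _ _ (n ^+ D.+1 * ((M + 4 / 2 ^+ k) * t ^+ D.+1 - 1))); last first.
  by rewrite ler_wpM2l ?exprn_ge0 ?(ltW n0) // lerB.
apply: (@le_trans _ _ (c * ((n * t) ^+ D.+1 * (1 + 2 ^+ D.+1 / (n * t))))).
  by rewrite ler_wpM2l.
rewrite exprMn -!mulrA mulrCA ler_wpM2l ?exprn_ge0 ?(ltW n0) //.
have ck : M + 4 / 2 ^+ k = c + 2 * 2 ^- k.
  by rewrite /c exprS invfM; field; rewrite gt_eqF.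
(* [A_lin] makes [2 ^+ D.+1 * c] at most [n], and 1/t is at most [2 ^- k]. *)
have last : c * (t ^+ D.+1 * (2 ^+ D.+1 / (n * t))) <= 2 ^- k * t ^+ D.+1.
  have -> : c * (t ^+ D.+1 * (2 ^+ D.+1 / (n * t))) = (2 ^+ D.+1 * c / n) * (t^-1 * t ^+ D.+1).
    by field; rewrite !gt_eqF.
  rewrite -[leRHS]mul1r; apply: ler_pM.
  - by rewrite divr_ge0 ?mulr_ge0 ?exprn_ge0 // ltW.
  - by rewrite mulr_ge0 ?invr_ge0 ?exprn_ge0 // ltW.
  - rewrite ler_pdivrMr // mul1r; apply: le_trans nA; apply: le_trans A_lin.
    by rewrite ler_wpM2l ?exprn_ge0.
  - by rewrite ler_wpM2r ?exprn_ge0 ?(ltW t0) // lef_pV2 ?posrE.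
rewrite ck; lra.
Qed.

Local Notation S := (block_subshift D a0 A_large).

Lemma patterns_ge k : (0 < k)%N -> (#|lab k| <= #|patterns R S (side k)|)%N.
Proof.
move=> k0; pose f (c : lab k) : {ffun {ffun 'I_D.+1 -> 'I_(side k)} -> A} :=
  [ffun v => cont c (fun i => (v : {ffun 'I_D.+1 -> 'I_(side k)}) i)].
have finj : injective f.
  move=> c c' /ffunP cc'; apply: (cont_inj A_large) => v vk.
  have := cc' [ffun i => Ordinal (vk i)]; rewrite !ffunE.
  by have -> : (fun i => [ffun i => Ordinal (vk i)] i : nat) = v by apply/funext => i; rewrite ffunE.
rewrite -(card_imset _ finj); apply/subset_leq_card/fintype.subsetP => _ /imsetP[c _ ->].
pose x0 : shift_space R S := point.
have [s _ H] := @block_occurs D A a0 A_large (sval x0) k 1 c (fun=> 0%N) (svalP x0) k0.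
rewrite inE; apply/asboolP; exists (saction (toZ s) x0); apply/ffunP => v.
by rewrite !ffunE /= -(H (fun i => v i)) // toZD.
Qed.

Lemma block_entropy : (M%:E <= topological_entropy R (@saction R D.+1 A S))%E.
Proof.
apply: topological_entropy_ge => N; exists (side N.+1).
  exact/ltnW/(side_ge _ _ A_large).
have sk : (0 : R) < (side N.+1)%:R by rewrite ltr0n (side_gt0 D a0 A_large).
rewrite /pattern_rate ler_pdivlMr ?exprn_gt0 //.
apply: (@le_trans _ _ (ln (#|lab N.+1|)%:R)); last first.
  rewrite ler_ln ?posrE ?ltr0n ?patterns_gt0 ?ler_nat ?patterns_ge //.
  by rewrite (leq_trans _ (card_lab D a0 N.+1)) // ltnW // ltnW // ltnW.
apply: le_trans (ln_lab_ge N.+1); apply: ler_pM => //.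
- by rewrite lerDl divr_ge0 // exprn_ge0.
- by rewrite lerXn2r ?nnegrE ?ler0n // ler_nat (sideE D a0 A_large) leq_addr.
Qed.

End BlockEntropy.

Theorem theorem1p1 (R : realType) (d : nat) (d_gt1 : (1 < d)%N)
    (M : R) (M_ge0 : 0 <= M) :
  exists (X : pmetricType R) (mu : probability (borel X) R)
         (T : 'rV[int]_d -> X -> X),
    [/\ compact [set: X],
        continuous_action T,
        totally_strictly_ergodic T,
        invariant_measure T [set: 'rV[int]_d] mu
      & (0%E < topological_entropy R T)%E /\
        (M%:E <= topological_entropy R T)%E].
Proof.
case: d d_gt1 => [//|D] _.
(* The two summands provide [A_exp] and [A_lin] for the bound [M + 1]; the final 3 provides
   [A_large]. *)
pose N := ((Num.trunc (expR (M + 5) + 2 ^+ D.+1 * (M + 5))).+1 + 3)%N.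
have NM : expR (M + 5) + 2 ^+ D.+1 * (M + 5) <= N%:R :> R.
  by apply: (le_trans (ltW (truncnS_gt _))); rewrite ler_nat leq_addr.
have M5 : 0 <= M + 5 by rewrite addr_ge0.
have A_large : (3 < #|'I_N.+1|)%N by rewrite card_ord /N; lia.
have NN : N%:R <= (#|'I_N.+1|)%:R :> R by rewrite card_ord ler_nat.
have E5 : M + 1 + 4 = M + 5 by lra.
have e0 : 0 <= 2 ^+ D.+1 * (M + 5) by rewrite mulr_ge0 // exprn_ge0.
pose S := block_subshift D (ord0 : 'I_N.+1) A_large.
have equi := @block_equidistributed D _ ord0 A_large R.
have [mu muI] := @invariant_probability R D.+1 _ S equi.
(* The bound [M + 1] also yields positive entropy when [M] is 0. *)
have ent : ((M + 1)%:E <= topological_entropy R (@saction R D.+1 _ S))%E.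
  apply: block_entropy; first by rewrite addr_ge0.
    rewrite E5 -[leLHS]expRK ler_ln ?posrE ?expR_gt0 ?card_ord ?ltr0n //.
    by rewrite card_ord in NN; apply: le_trans NN; apply: le_trans NM; rewrite lerDl.
  by rewrite E5; apply: le_trans NN; apply: le_trans NM; rewrite lerDr expR_ge0.
exists (shift_space R S), mu, (@saction R D.+1 _ S); split.
- exact: shift_space_compact.
- exact: saction_action.
- by apply: saction_totally_strictly_ergodic => //; exact: block_recurrent.
- exact: muI.
- by split; apply: lt_le_trans ent || apply: le_trans ent; rewrite ?lte_fin ?lee_fin; lra.
Qed.
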